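(* Let $q$ be an odd prime power, $A=\mathbb{F}_q[T]$, $F=\mathbb{F}_q(T)$, and let $\psi: A\to F\{\tau\}$ be a Drinfeld module of rank $2$ over $F$ with $\operatorname{End}_{F^{\mathrm{alg}}}(\psi)=A$. Then there is a constant $C>0$, depending only on $q$ and on the coefficients of $\psi_T\in F\{\tau\}$, such that for every prime $\mathfrak{p}=pA$ of good reduction for $\psi$ (with $p$ the monic generator of $\mathfrak{p}$), $$|\Delta_{\mathfrak{p}}|\ \geq\ C\,\frac{\log|p|}{(\log\log|p|)^2},$$ where $\Delta_{\mathfrak{p}}$ is the discriminant of the $A$-order $\operatorname{End}_{\mathbb{F}_{\mathfrak{p}}}(\psi\otimes\mathbb{F}_{\mathfrak{p}})$.
   Context: $F^{\mathrm{alg}}$ is a fixed algebraic closure of $F$. A prime of $A$ is a nonzero prime ideal $\mathfrak{p}$ of $A$, and $\mathbb{F}_{\mathfrak{p}}=A/\mathfrak{p}$. An $A$-field is a field $L$ with a ring homomorphism $\gamma:A\to L$ (the natural inclusion if $L\supseteq F$; the natural map $A\to A/\mathfrak{p}\hookrightarrow L$ if $L$ is a finite extension of $\mathbb{F}_{\mathfrak{p}}$). $L\{\tau\}$ is the ring of noncommutative polynomials in $\tau$ with $\tau c=c^q\tau$ for $c\in L$. A Drinfeld module of rank $r\ge 1$ over $L$ is an $\mathbb{F}_q$-algebra homomorphism $\psi:A\to L\{\tau\}$, $a\mapsto\psi_a$, with $\psi_T=\gamma(T)+\sum_{i=1}^r g_i\tau^i$, $g_i\in L$, $g_r\ne0$.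 For $L'\supseteq L$, $\operatorname{End}_{L'}(\psi)=\{u\in L'\{\tau\}: u\psi_a=\psi_a u\ \forall a\in A\}$; it contains $\psi(A)\cong A$, and $\operatorname{End}_{F^{\mathrm{alg}}}(\psi)=A$ means that it equals $\psi(A)$. For $\psi$ of rank $2$ over $F$ with $\psi_T=T+g_1\tau+g_2\tau^2$, a prime $\mathfrak{p}$ is of good reduction if $\operatorname{ord}_{\mathfrak{p}}(g_1)\ge0$ and $\operatorname{ord}_{\mathfrak{p}}(g_2)=0$; then the reduction $\psi\otimes\mathbb{F}_{\mathfrak{p}}:A\to\mathbb{F}_{\mathfrak{p}}\{\tau\}$ is the rank $2$ Drinfeld module obtained by reducing the coefficients of $\psi_T$ modulo $\mathfrak{p}$. Let $\pi_{\mathfrak{p}}=\tau^{\deg p}$. It is known that $\mathcal{E}_{\psi,\mathfrak{p}}=\operatorname{End}_{\mathbb{F}_{\mathfrak{p}}}(\psi\otimes\mathbb{F}_{\mathfrak{p}})$ is an $A$-order (free of rank $2$ over $A$) in the quadratic extension $F(\pi_{\mathfrak{p}})$ of $F$, which is imaginary (only one place lies over the place $\infty=1/T$). For an $A$-basis $\alpha_1,\alpha_2$ of $\mathcal{E}_{\psi,\mathfrak{p}}$, $\Delta_{\mathfrak{p}}=\det(\operatorname{Tr}_{F(\pi_{\mathfrak{p}})/F}(\alpha_i\alpha_j))_{1\le i,j\le2}\in A$, well defined up to multiplication by a square in $\mathbb{F}_q^\times$. The absolute value is $|a|=q^{\deg a}$ for $a\in A$. *)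

(* Defs.v *)
From HB Require Import structures.
From mathcomp Require Import all_boot all_order all_fingroup all_algebra.
From mathcomp Require Import all_solvable all_field.
From mathcomp Require Import generic_quotient boolp constructive_ereal reals exp.

Set Implicit Arguments.
Unset Strict Implicit.
Unset Printing Implicit Defensive.

Import Order.TTheory GRing.Theory Num.Theory.
Local Open Scope ring_scope.

(* The skew polynomial ring R{tau; sigma}, tau * c = sigma c * tau.  An element
   is the polynomial of its left coefficients: \sum_i u`_i tau^i. *)
Definition skewpoly (R : nzRingType) (sigma : {rmorphism R -> R}) : Type :=
  {poly R}.

Section SkewPoly.
Variables (R : nzRingType) (sigma : {rmorphism R -> R}).
Local Notation S := (skewpoly sigma).

HB.instance Definition _ := GRing.Zmodule.on S.

Definition skew_mul (u v : S) : S :=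
  \poly_(k < (size u + size v).-1)
     \sum_(i < k.+1) u`_i * iter i sigma v`_(k - i).

Lemma iter_sigma0 i : iter i sigma 0 = 0.
Proof. by elim: i => //= i ->; rewrite rmorph0. Qed.

Lemma iter_sigma1 i : iter i sigma 1 = 1.
Proof. by elim: i => //= i ->; rewrite rmorph1. Qed.

Lemma iter_sigmaD i x y : iter i sigma (x + y) = iter i sigma x + iter i sigma y.
Proof. by elim: i => //= i ->; rewrite rmorphD. Qed.

Lemma iter_sigmaM i x y : iter i sigma (x * y) = iter i sigma x * iter i sigma y.
Proof. by elim: i => //= i ->; rewrite rmorphM. Qed.

Lemma iter_sigma_sum i (I : Type) (r : seq I) (P : pred I) (f : I -> R) :
  iter i sigma (\sum_(j <- r | P j) f j) = \sum_(j <- r | P j) iter i sigma (f j).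
Proof.
by apply: (big_morph _ (iter_sigmaD i) (iter_sigma0 i)).
Qed.

Lemma coef_skew_mul (u v : S) k :
  (skew_mul u v)`_k = \sum_(i < k.+1) u`_i * iter i sigma v`_(k - i).
Proof.
rewrite coef_poly ltn_predRL; case: leqP => // le_uv_k1.
rewrite big1 // => j _; have [lq_u_j|lt_j_u] := leqP (size u) j.
  by rewrite nth_default ?mul0r.
rewrite [v`__]nth_default ?iter_sigma0 ?mulr0 // leq_subRL -ltnS //.
by rewrite (leq_trans _ le_uv_k1) // ltn_add2r.
Qed.

Lemma coef_skew_mul_rev (u v : S) k :
  (skew_mul u v)`_k = \sum_(i < k.+1) u`_(k - i) * iter (k - i) sigma v`_i.
Proof.
rewrite coef_skew_mul (reindex_inj rev_ord_inj) /=.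
by apply: eq_bigr => j _; rewrite subSS (subKn (leq_ord j)).
Qed.

Lemma skew_mulA : associative skew_mul.
Proof.
move=> p q r; apply/polyP=> i; rewrite coef_skew_mul coef_skew_mul_rev.
pose coef3 j k :=
  p`_j * (iter j sigma q`_(i - j - k) * iter (i - k) sigma r`_k).
transitivity (\sum_(j < i.+1) \sum_(k < i.+1 | (k <= i - j)%N) coef3 j k).
  apply: eq_bigr => /= j _; rewrite coef_skew_mul_rev iter_sigma_sum big_distrr /=.
  rewrite (big_ord_narrow_leq (leq_subr _ _)); apply: eq_bigr => k _.
  rewrite /coef3 iter_sigmaM -iterD /=; congr (_ * (_ * iter _ _ _)).
  have := leq_ord j; have := leq_ord k => /= hk hj.
  by rewrite addnBA // subnKC.
rewrite (exchange_big_dep predT) //=; apply: eq_bigr => k _.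
transitivity (\sum_(j < i.+1 | (j <= i - k)%N) coef3 j k).
  apply: eq_bigl => j; rewrite -ltnS -(ltnS j) -!subSn ?leq_ord //.
  by rewrite -subn_gt0 -(subn_gt0 j) -!subnDA addnC.
rewrite (big_ord_narrow_leq (leq_subr _ _)) coef_skew_mul big_distrl /=.
by apply: eq_bigr => j _; rewrite /coef3 -!subnDA addnC mulrA.
Qed.

Lemma skew_mul1l : left_id (1%:P : S) skew_mul.
Proof.
move=> p; apply/polyP => i; rewrite coef_skew_mul big_ord_recl subn0 /=.
by rewrite big1 => [|j _]; rewrite coefC /= ?mul0r // mul1r addr0.
Qed.

Lemma skew_mul1r : right_id (1%:P : S) skew_mul.
Proof.
move=> p; apply/polyP => i; rewrite coef_skew_mul_rev big_ord_recl subn0 /=.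
rewrite big1 => [|j _]; rewrite coefC /= ?iter_sigma0 ?mulr0 //.
by rewrite iter_sigma1 mulr1 addr0.
Qed.

Lemma skew_mulDl : left_distributive skew_mul +%R.
Proof.
move=> p q r; apply/polyP=> i; rewrite coefD !coef_skew_mul -big_split.
by apply: eq_bigr => j _; rewrite coefD mulrDl.
Qed.

Lemma skew_mulDr : right_distributive skew_mul +%R.
Proof.
move=> p q r; apply/polyP=> i; rewrite coefD !coef_skew_mul -big_split.
by apply: eq_bigr => j _; rewrite coefD iter_sigmaD mulrDr.
Qed.

Lemma skew1_neq0 : (1%:P : S) != 0.
Proof. by rewrite polyC_eq0 oner_neq0. Qed.

HB.instance Definition _ := GRing.Zmodule_isNzRing.Build S
  skew_mulA skew_mul1l skew_mul1r skew_mulDl skew_mulDr skew1_neq0.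

Definition tau : S := 'X.

Definition skewC (c : R) : S := c%:P.

Lemma coef_skewM (u v : S) k :
  (u * v : S)`_k = \sum_(i < k.+1) u`_i * iter i sigma v`_(k - i).
Proof. exact: coef_skew_mul. Qed.

Lemma coef_skewCM c (u : S) k : (skewC c * u : S)`_k = c * u`_k.
Proof.
rewrite coef_skewM big_ord_recl subn0 coefC /= big1 ?addr0 // => i _.
by rewrite coefC /= mul0r.
Qed.

Lemma coef_skewMC c (u : S) k : (u * skewC c : S)`_k = u`_k * iter k sigma c.
Proof.
rewrite coef_skewM big_ord_recr /= subnn coefC /= big1 ?add0r // => i _.
by rewrite coefC subn_eq0 leqNgt ltn_ord /= iter_sigma0 mulr0.
Qed.

Lemma coef_tauM (u : S) k : (tau * u : S)`_k.+1 = sigma u`_k.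
Proof.
rewrite coef_skewM big_ord_recl coefX mul0r add0r big_ord_recl coefX mul1r.
by rewrite big1 => [|i _]; rewrite ?coefX ?mul0r // addr0 subSS subn0.
Qed.

Lemma coef0_tauM (u : S) : (tau * u : S)`_0 = 0.
Proof. by rewrite coef_skewM big_ord1 coefX mul0r. Qed.

Lemma tau_skewC c : tau * skewC c = skewC (sigma c) * tau.
Proof.
apply/polyP => -[|k]; rewrite coef_skewCM coefX ?coef0_tauM ?mulr0 //.
by rewrite coef_tauM coefC; case: k => [|k] /=; rewrite ?mulr1 // rmorph0 mulr0.
Qed.

Lemma coef_tauXM n (u : S) k :
  (tau ^+ n * u : S)`_k = if (k < n)%N then 0 else iter n sigma u`_(k - n).
Proof.
elim: n k => [|n IH] [|k]; rewrite ?expr0 ?mul1r // exprS -mulrA.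
  by rewrite coef0_tauM.
by rewrite coef_tauM IH ltnS subSS; case: ifP => // _; rewrite rmorph0.
Qed.

Lemma coef_MtauX n (u : S) k :
  (u * tau ^+ n : S)`_k = if (k < n)%N then 0 else u`_(k - n).
Proof.
rewrite coef_skewM; have tauXE m : (tau ^+ n : S)`_m = (m == n)%:R.
  rewrite -[_ ^+ _]mulr1 coef_tauXM coefC subn_eq0; case: ltngtP => _ //=.
    by rewrite iter_sigma0.
  by rewrite iter_sigma1.
under eq_bigr do rewrite tauXE.
case: ltnP => [lt_kn|le_nk].
  rewrite big1 // => i _; rewrite ltn_eqF ?iter_sigma0 ?mulr0 //.
  exact: leq_ltn_trans (leq_subr _ _) lt_kn.
have lt_i : (k - n < k.+1)%N by rewrite ltnS leq_subr.
rewrite (bigD1 (Ordinal lt_i)) //= big1 => [|i ne_i].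
  by rewrite addr0 (_ : (_ == n) = true) ?iter_sigma1 ?mulr1 //; apply/eqP/subKn.
rewrite (_ : (_ == n) = false) ?iter_sigma0 ?mulr0 //.
apply: contraNF ne_i => /eqP e_n; apply/eqP/val_inj => /=.
by rewrite -e_n subKn // -ltnS.
Qed.

Fact skewC_zmod_morphism : zmod_morphism skewC.
Proof. exact: polyCB. Qed.

Fact skewC_monoid_morphism : monoid_morphism skewC.
Proof.
by split=> // x y; apply/polyP => k; rewrite coef_skewCM !coefC; case: ifP; rewrite ?mulr0.
Qed.

HB.instance Definition _ := GRing.isZmodMorphism.Build R S skewC skewC_zmod_morphism.
HB.instance Definition _ := GRing.isMonoidMorphism.Build R S skewC skewC_monoid_morphism.

End SkewPoly.

Section Drinfeld.
Variables (Fq : finFieldType) (L : fieldType).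
Variable gamma : {rmorphism {poly Fq} -> L}.

(* gamma is only there to make the canonical morphism structure available. *)
Definition frobq (g : {rmorphism {poly Fq} -> L}) (x : L) : L := x ^+ #|Fq|.

Lemma frobqD : {morph frobq gamma : x y / x + y}.
Proof.
move=> x y; have [p pr_p chFq] := finPcharP Fq.
have chL : p \in [pchar L].
  by apply: (rmorph_pchar gamma); apply: (rmorph_pchar (@polyC Fq)).
apply: exprDn_pchar; rewrite (eq_pnat _ (pcharf_eq chL)).
have := fin_ring_pchar_abelem chFq => /abelem_pgroup.
by rewrite /pgroup cardsT.
Qed.

Fact frobq_zmod_morphism : zmod_morphism (frobq gamma).
Proof. by move=> x y; apply: (addIr (frobq gamma y)); rewrite -frobqD !subrK. Qed.

Fact frobq_monoid_morphism : monoid_morphism (frobq gamma).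
Proof. by split=> [|x y]; rewrite /frobq ?expr1n ?exprMn. Qed.

HB.instance Definition _ :=
  GRing.isZmodMorphism.Build L L (frobq gamma) frobq_zmod_morphism.
HB.instance Definition _ :=
  GRing.isMonoidMorphism.Build L L (frobq gamma) frobq_monoid_morphism.

(* L{tau}, with tau * c = c ^+ #|Fq| * tau. *)
Definition twist : Type := skewpoly (frobq gamma).
HB.instance Definition _ := GRing.NzRing.on twist.

Definition is_drinfeld (r : nat) (psi : {rmorphism {poly Fq} -> twist}) : Prop :=
  [/\ (0 < r)%N,
      forall c : Fq, psi c%:P = skewC (frobq gamma) (gamma c%:P),
      (psi 'X)`_0 = gamma 'X
    & size (psi 'X) = r.+1].

Definition endo (phi : {poly Fq} -> twist) : {pred twist} :=
  fun u => `[< forall a, u * phi a = phi a * u >].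

Lemma endoP (phi : {poly Fq} -> twist) (u : twist) :
  reflect (forall a, u * phi a = phi a * u) (u \in endo phi).
Proof. exact: asboolP. Qed.

Fact endo_subring_closed phi : subring_closed (endo phi).
Proof.
split.
- by apply/endoP => a; rewrite mul1r mulr1.
- move=> u v /endoP uP /endoP vP; apply/endoP => a.
  by rewrite mulrBl mulrBr uP vP.
- move=> u v /endoP uP /endoP vP; apply/endoP => a.
  by rewrite -mulrA vP !mulrA uP.
Qed.

HB.instance Definition _ phi :=
  GRing.isSubringClosed.Build twist (endo phi) (endo_subring_closed phi).

Record endo_ring (phi : {poly Fq} -> twist) : Type :=
  EndoRing { endo_val : twist; _ : endo_val \in endo phi }.

HB.instance Definition _ phi := [isSub for @endo_val phi].
HB.instance Definition _ phi := [Choice of endo_ring phi by <:].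
HB.instance Definition _ phi := [SubChoice_isSubNzRing of endo_ring phi by <:].

Fact scalar_endo (phi : {rmorphism {poly Fq} -> twist}) a : phi a \in endo phi.
Proof. by apply/endoP => b; rewrite -!rmorphM mulrC. Qed.

Definition endo_scalar (phi : {rmorphism {poly Fq} -> twist}) a : endo_ring phi :=
  EndoRing (scalar_endo phi a).

Lemma skewC_gamma_comm (u : twist) :
  commr_rmorph (skewC (frobq gamma) \o gamma \o @polyC Fq) u.
Proof.
move=> c; apply/polyP => k; rewrite coef_skewMC coef_skewCM /= mulrC.
congr (_ * _); elim: k => //= k ->.
by rewrite /frobq -!rmorphXn /= expf_card.
Qed.

(* The F_q-algebra morphism A -> L{tau} mapping T to u. *)
Definition twist_morph (u : twist) : {rmorphism {poly Fq} -> twist} :=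
  horner_morph (skewC_gamma_comm u).

End Drinfeld.

Section BaseChange.
Variables (Fq : finFieldType) (L L' : fieldType).
Variables (gamma : {rmorphism {poly Fq} -> L}) (iota : {rmorphism L -> L'}).

Definition base_change (psi : {poly Fq} -> twist gamma) (a : {poly Fq}) :
  twist (iota \o gamma) := map_poly iota (psi a).

End BaseChange.

Section RationalFunctions.
Variable Fq : finFieldType.
Local Notation A := {poly Fq}.
Local Notation F := {fraction {poly Fq}}.
Local Notation gammaF := (@FracField.tofrac {poly Fq}).
Local Notation "x %:F" := (@FracField.tofrac {poly Fq} x).

(* Numerator and denominator in lowest terms. *)
Definition fnum (x : F) : A := \n_(repr x) %/ gcdp \n_(repr x) \d_(repr x).
Definition fden (x : F) : A := \d_(repr x) %/ gcdp \n_(repr x) \d_(repr x).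

Lemma fden_neq0 (x : F) : fden x != 0.
Proof.
rewrite /fden divpN0 ?gcdp_eq0 ?negb_and ?denom_ratioP ?orbT //.
by rewrite dvdp_leq ?dvdp_gcdr ?denom_ratioP.
Qed.

Lemma fnum_fden_coprime (x : F) : coprimep (fnum x) (fden x).
Proof. by apply: coprimep_div_gcd; rewrite denom_ratioP orbT. Qed.

Lemma fracE (x : F) : x = (fnum x)%:F / (fden x)%:F.
Proof.
have xd : x * (\d_(repr x))%:F = (\n_(repr x))%:F.
  rewrite -{1}[x]reprK; unlock FracField.tofrac; rewrite -[LHS]FracField.pi_mul.
  apply/eqmodP; rewrite /= FracField.equivfE /FracField.mulf.
  by rewrite !numden_Ratio ?mulf_neq0 ?oner_neq0 ?denom_ratioP // !mulr1 mulrC.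
have g0 : (gcdp \n_(repr x) \d_(repr x))%:F != 0.
  by rewrite tofrac_eq0 gcdp_eq0 negb_and denom_ratioP orbT.
apply: (canRL (mulfK _)); first by rewrite tofrac_eq0 fden_neq0.
apply: (mulIf g0); rewrite -mulrA -!tofracM /fnum /fden.
by rewrite !divpK ?dvdp_gcdl ?dvdp_gcdr.
Qed.

(* The exponent of p in a, for 1 < size p and a != 0; then p ^+ k %| a forces
   k < size a. *)
Definition pmult (p a : A) : nat := \max_(k < size a | p ^+ k %| a) k.

Definition pord (p : A) (x : F) : \bar int :=
  if x == 0 then +oo%E else ((pmult p (fnum x))%:Z - (pmult p (fden x))%:Z)%:E.

Definition absA (R : realType) (a : A) : R :=
  if a == 0 then 0 else #|Fq|%:R ^+ (size a).-1.

Definition good_reduction (p : A) (psi : A -> twist gammaF) : Prop :=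
  (0%:E <= pord p (psi 'X)`_1)%E /\ pord p (psi 'X)`_2 = 0%:E.

Section Residue.
Variables (p : A) (mi : monic_irreducible_poly p).
Local Notation Fp := {poly %/ p with mi}.

Definition residue (a : A) : Fp := in_qpoly p a.

Fact residue_zmod_morphism : zmod_morphism residue.
Proof. exact: (raddfB (in_qpoly p)). Qed.

Fact residue_monoid_morphism : monoid_morphism residue.
Proof. exact: in_qpoly_monoid_morphism. Qed.

HB.instance Definition _ :=
  GRing.isZmodMorphism.Build A Fp residue residue_zmod_morphism.
HB.instance Definition _ :=
  GRing.isMonoidMorphism.Build A Fp residue residue_monoid_morphism.

(* Junk unless 0 <= pord p x; see fresidueE below. *)
Definition fresidue (x : F) : Fp := residue (fnum x) / residue (fden x).

Definition reduction (psi : A -> twist gammaF) : {rmorphism A -> twist residue} :=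
  twist_morph (map_poly fresidue (psi 'X) : twist residue).

Lemma residue_eq0 a : (residue a == 0) = (p %| a).
Proof.
have [_ mon] := mi.
by rewrite -(inj_eq val_inj) /= mk_monicE // -Pdiv.IdomainMonic.modpE.
Qed.

Lemma fresidueE a b : ~~ (p %| b) ->
  fresidue (a%:F / b%:F) = residue a / residue b.
Proof.
move=> pb; set x := _ / _.
have b0 : b != 0 by apply: contraNneq pb => ->; exact: dvdp0.
have e : fnum x * b = a * fden x.
  apply/eqP; rewrite -tofrac_eq !tofracM; apply/eqP.
  have := fracE x; rewrite {1}/x => /eqP; rewrite eqr_div ?tofrac_eq0 ?fden_neq0 //.
  by move/eqP=> <-.
have pd : ~~ (p %| fden x).
  apply: contra pb => pd.
  have : p %| fnum x * b by rewrite e dvdp_mull.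
  rewrite Gauss_dvdpr //; apply: (coprimep_dvdr pd).
  by rewrite coprimep_sym fnum_fden_coprime.
apply/eqP; rewrite /fresidue eqr_div ?residue_eq0 //.
by rewrite -!rmorphM e.
Qed.

Lemma pmult_eq0 a : a != 0 -> (pmult p a == 0)%N = ~~ (p %| a).
Proof.
move=> a0; have [[p1 _] _] := mi; rewrite /pmult.
apply/idP/idP => [|pa].
  apply: contraL => pa; rewrite -lt0n.
  have sa : (1 < size a)%N by rewrite (leq_trans p1) // dvdp_leq.
  by rewrite (bigD1 (Ordinal sa)) ?expr1 //= leq_max.
rewrite -leqn0; apply/bigmax_leqP => -[[|k] /= _] //.
by move/(dvdp_trans (dvdp_exp2l p (ltn0Sn k))); rewrite expr1 (negPf pa).
Qed.

Lemma fresidue_neq0 x : pord p x = 0%:E -> fresidue x != 0.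
Proof.
rewrite /pord; case: eqP => // /eqP x0 [] /eqP; rewrite subr_eq0 eqz_nat => /eqP e.
have n0 : fnum x != 0.
  by apply: contraNneq x0 => n0; rewrite (fracE x) n0 tofrac0 mul0r.
have : ~~ (p %| fnum x) || ~~ (p %| fden x).
  rewrite -negb_and -dvdp_gcd.
  have [[p1 _] _] := mi; have /eqp_dvdr -> : gcdp (fnum x) (fden x) %= 1.
    by rewrite -size_poly_eq1; exact: fnum_fden_coprime.
  by rewrite dvdp1 neq_ltn p1 orbT.
rewrite -!pmult_eq0 ?fden_neq0 // e orbb => d0.
by rewrite mulf_neq0 ?invr_eq0 ?residue_eq0 // -pmult_eq0 ?fden_neq0 // ?e.
Qed.

Lemma fresidue_tofrac a : fresidue a%:F = residue a.
Proof.
rewrite -[a%:F]divr1 -tofrac1 fresidueE ?rmorph1 ?divr1 //.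
by rewrite dvdp1; case: mi => -[p1 _] _; rewrite neq_ltn p1 orbT.
Qed.

Lemma reduction_drinfeld (psi : {rmorphism A -> twist gammaF}) :
  is_drinfeld 2 psi -> good_reduction p psi -> is_drinfeld 2 (reduction psi).
Proof.
case=> _ psiC psi0 psi_sz [_ g2].
have redX : reduction psi 'X = map_poly fresidue (psi 'X).
  exact: horner_morphX.
have f0 : fresidue 0 = 0 by rewrite -tofrac0 fresidue_tofrac rmorph0.
split=> //.
- by move=> c; exact: horner_morphC.
- by rewrite redX coef_map_id0 // psi0 fresidue_tofrac.
by rewrite redX size_map_poly_id0 // lead_coefE psi_sz fresidue_neq0.
Qed.

Lemma iter_frobq_residue (x : Fp) : iter (size p).-1 (frobq residue) x = x.
Proof.
have iterE n : iter n (frobq residue) x = x ^+ (#|Fq| ^ n).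
  by elim: n => [|n IH] /=; rewrite ?expr1 // IH /frobq -exprM expnSr.
by rewrite iterE -(card_qfpoly mi); exact: expf_card.
Qed.

Fact frobenius_endo (phi : A -> twist residue) :
  (tau (frobq residue) : twist residue) ^+ (size p).-1 \in endo phi.
Proof.
apply/endoP => a; apply/polyP => k.
rewrite [LHS]coef_tauXM [RHS]coef_MtauX; case: ifP => // _.
exact: iter_frobq_residue.
Qed.

Definition frobenius (phi : A -> twist residue) : endo_ring phi :=
  EndoRing (frobenius_endo phi).

End Residue.
End RationalFunctions.

Definition fext_trace (F0 : fieldType) (K : fieldExtType F0) (x : K) : F0 :=
  \tr (passmx.mxof (vbasis {:K}) (vbasis {:K}) (amull x)).

Section EndoDiscriminant.
Variables (Fq : finFieldType) (L : fieldType).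
Local Notation A := {poly Fq}.
Local Notation F := {fraction {poly Fq}}.
Variables (gamma : {rmorphism A -> L}) (phi : {rmorphism A -> twist gamma}).

(* {poly Fq} acts on endo_ring phi by left multiplication through phi. *)
Definition endo_basis (n : nat) (alpha : 'I_n -> endo_ring phi) : Prop :=
  forall u, exists! c : {ffun 'I_n -> A},
    u = \sum_i endo_scalar phi (c i) * alpha i.

Variables (K : fieldExtType F) (j : {rmorphism endo_ring phi -> K}).

(* K is F(pi), with endo_ring phi embedded in it over {poly Fq} by j. *)
Definition generated_field (pi : endo_ring phi) : Prop :=
  [/\ injective j, forall a, j (endo_scalar phi a) = (FracField.tofrac a)%:A
    & <<1; j pi>>%VS = {:K}%VS].

Definition endo_disc (n : nat) (alpha : 'I_n -> endo_ring phi) : F :=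
  \det (\matrix_(i < n, k < n) fext_trace (j (alpha i) * j (alpha k))).

End EndoDiscriminant.

(* Main.v *)
(* Since Tr(1) = 2 is a unit, the order has an A-basis 1, beta with Tr(beta) = 0,
   and then Delta = beta^2 up to squares of units.  So the element u of F_p{tau}
   underlying beta has tau-degree at most d = deg Delta and constant term a
   square root s of Delta.  The relation u psi_T = psi_T u determines the
   coefficients of u recursively from s:
     u_k (T^(q^k) - T) = g1 u_(k-1)^q - g1^(q^(k-1)) u_(k-1)
                         + g2 u_(k-2)^(q^2) - g2^(q^(k-2)) u_(k-2),
   as long as k < deg p.  Up to powers of a common denominator of g1, g2, this
   gives u_k = s * num_k / den_k with num_k, den_k in A that depend only on psi
   and Delta.  As u_(d+1) = u_(d+2) = 0, the prime p divides num_(d+1) and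
   num_(d+2).  These are not both 0: otherwise the same formulas over F^alg would
   define an endomorphism of psi with constant term sqrt(Delta), which is not in
   A.  Hence deg p <= deg num_k = O(d q^d), even better than required. *)
Require Import Defs.
From HB Require Import structures.
From mathcomp Require Import all_boot all_order all_fingroup all_algebra.
From mathcomp Require Import all_solvable all_field.
From mathcomp Require Import boolp constructive_ereal reals exp.
From mathcomp Require Import ring lra zify.

Set Implicit Arguments.
Unset Strict Implicit.
Unset Printing Implicit Defensive.

Import Order.TTheory GRing.Theory Num.Theory.
Local Open Scope ring_scope.

(** * Traces and the discriminant of a quadratic order *)

(** Factor [f] as the identity composed with [f] through the other basis and use tr(MN) = tr(NM).
    This frees [fext_trace] from its built-in basis. *)
Lemma mxtrace_mxof (F : fieldType) (vT : vectType F)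
    (b e : (\dim {:vT}).-tuple vT) (f : 'End(vT)) :
  basis_of {:vT} b -> basis_of {:vT} e ->
  \tr (passmx.mxof b b f) = \tr (passmx.mxof e e f).
Proof.
move=> bB eB; rewrite -{1}[f]comp_lfun1l (passmx.mxof_comp b b eB).
by rewrite mxtrace_mulC -(passmx.mxof_comp e e bB) comp_lfun1r.
Qed.

Lemma fext_traceE (F : fieldType) (K : fieldExtType F) (n : nat)
    (e : n.-tuple K) (x : K) :
  basis_of {:K} e -> fext_trace x = \sum_i coord e i (x * e`_i).
Proof.
move=> eB; have dimK := size_basis eB; subst n.
rewrite /fext_trace (mxtrace_mxof _ (vbasisP _) eB).
by apply: eq_bigr => i _; rewrite !mxE /= passmx.vecof_delta lfunE.
Qed.

Section QuadraticTrace.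
Variables (F : fieldType) (K : fieldExtType F) (e : 2.-tuple K).
Hypothesis e_basis : basis_of {:K} e.

Lemma fext_traceD (x y : K) : fext_trace (x + y) = fext_trace x + fext_trace y.
Proof.
rewrite !(fext_traceE _ e_basis) -big_split; apply: eq_bigr => i _.
by rewrite mulrDl linearD.
Qed.

Lemma fext_traceZ a (x : K) : fext_trace (a *: x) = a * fext_trace x.
Proof.
rewrite !(fext_traceE _ e_basis) mulr_sumr; apply: eq_bigr => i _.
by rewrite -scalerAl linearZ.
Qed.

Lemma fext_traceB (x y : K) : fext_trace (x - y) = fext_trace x - fext_trace y.
Proof. by rewrite -scaleN1r fext_traceD fext_traceZ mulN1r. Qed.

Lemma fext_trace1 : fext_trace (1 : K) = 2%:R.
Proof.
rewrite (fext_traceE _ e_basis) big_ord_recl big_ord1 !mul1r.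
by rewrite !coord_free ?(basis_free e_basis) // eqxx.
Qed.

(* Cayley-Hamilton, with the norm eliminated through 2 N(x) = Tr(x)^2 - Tr(x^2). *)
Lemma sqr_fext_trace0 (x : K) :
  fext_trace x = 0 -> 2%:R *: x ^+ 2 = (fext_trace (x ^+ 2))%:A.
Proof.
have eE y : y = coord e ord0 y *: e`_0 + coord e (lift ord0 ord0) y *: e`_1.
  rewrite {1}(coord_basis e_basis (memvf y)).
  by rewrite big_ord_recl big_ord1.
have coordE a b i : coord e i (a *: e`_0 + b *: e`_1) = if i == 0 then a else b.
  have fe := basis_free e_basis.
  rewrite linearD !linearZ /= (coord_free ord0 i fe) (coord_free (lift ord0 ord0) i fe).
  by case: (unliftP ord0 i) => [k|] ->;
    rewrite ?(ord1 k) /= !(mulr0, mulr1, addr0, add0r).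
have e0 : e`_0 != 0.
  apply/eqP => e0; have := free_not0 (basis_free e_basis).
  move/(_ _ (mem_nth 0 (_ : (0 < size e)%N))); rewrite size_tuple e0.
  by move=> /(_ isT) /eqP.
rewrite !(fext_traceE _ e_basis) !big_ord_recl !big_ord0 !addr0 /=.
have := eE (x * e`_0); have := eE (x * e`_1).
set a := coord e ord0 (x * e`_0); set b := coord _ _ (x * e`_0).
set c := coord e ord0 (x * e`_1); set d := coord _ _ (x * e`_1).
move=> xe1 xe0 tr0.
have -> : x ^+ 2 * e`_0 = (a * a + b * c) *: e`_0 + (a * b + b * d) *: e`_1.
  rewrite expr2 -mulrA xe0 mulrDr -!scalerAr xe0 xe1 !scalerDr !scalerA.
  by rewrite !scalerDl addrACA.
have -> : x ^+ 2 * e`_1 = (c * a + d * c) *: e`_0 + (c * b + d * d) *: e`_1.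
  rewrite expr2 -mulrA xe1 mulrDr -!scalerAr xe0 xe1 !scalerDr !scalerA.
  by rewrite !scalerDl addrACA.
rewrite !coordE /=; have dE : d = - a by apply/eqP; rewrite -addr_eq0 addrC tr0.
set z := RHS; have {z} -> : z = (2%:R * (a * a + b * c)) %:A.
  rewrite {}/z; congr (_ *: _). rewrite dE; ring.
rewrite -scalerA; congr (_ *: _); apply: (mulIf e0); rewrite -scalerAl mul1r.
rewrite expr2 -mulrA xe0 mulrDr -!scalerAr xe0 xe1 !scalerDr !scalerA dE.
rewrite addrACA -!scalerDl (_ : a * b + b * - a = 0) ?scale0r ?addr0 //.
by ring.
Qed.
End QuadraticTrace.

Section EndoDisc.
Variables (Fq : finFieldType) (L : fieldType).
Local Notation A := {poly Fq}.
Local Notation F := {fraction {poly Fq}}.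
Local Notation "x %:F" := (@FracField.tofrac {poly Fq} x).
Variables (gamma : {rmorphism A -> L}) (phi : {rmorphism A -> twist gamma}).
Variables (K : fieldExtType F) (j : {rmorphism endo_ring phi -> K}).
Variables (pi : endo_ring phi) (alpha : 'I_2 -> endo_ring phi).
Hypotheses (j_gen : generated_field j pi) (alphaP : endo_basis alpha).

Let i0 : 'I_2 := ord0.
Let i1 : 'I_2 := lift ord0 ord0.
Let e := [tuple j (alpha i0); j (alpha i1)].

Lemma endo_basis_coord u :
  exists a b : A, j u = a%:F *: j (alpha i0) + b%:F *: j (alpha i1).
Proof.
have [_ jA _] := j_gen; have [c [uE _]] := alphaP u.
exists (c i0), (c i1); rewrite uE big_ord_recl big_ord1 rmorphD !rmorphM !jA.
by rewrite -!scalerAl !mul1r.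
Qed.

Lemma endo_basis_free (a b : A) :
  a%:F *: j (alpha i0) + b%:F *: j (alpha i1) = 0 -> a = 0 /\ b = 0.
Proof.
have [j_inj jA _] := j_gen => eq0.
have [c [_ c_uniq]] := alphaP 0.
pose c' := [ffun i : 'I_2 => if i == i0 then a else b].
have e1 : c = [ffun=> 0].
  apply: c_uniq; rewrite big1 // => i _; rewrite ffunE.
  by apply: j_inj; rewrite rmorphM jA tofrac0 scale0r mul0r rmorph0.
have e2 : c = c'.
  apply: c_uniq; apply: j_inj; rewrite rmorph0 -eq0 big_ord_recl big_ord1.
  by rewrite rmorphD !rmorphM !jA -!scalerAl !mul1r !ffunE.
split; [have := congr1 (fun f : {ffun _} => f i0) e2 |
        have := congr1 (fun f : {ffun _} => f i1) e2];
  by rewrite e1 !ffunE.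
Qed.

(** K consists of polynomials in [j pi], whose powers lie in the image of the order, so [e] spans. A
    linear relation over F becomes one over A after clearing the denominators of its two
    coefficients. *)
Lemma endo_basis_of : basis_of {:K} e.
Proof.
have [j_inj jA j_span] := j_gen.
have mem_j u : j u \in <<e>>%VS.
  have [a [b ->]] := endo_basis_coord u.
  by apply: rpredD; apply: rpredZ; apply: memv_span; rewrite !inE eqxx ?orbT.
apply/andP; split.
  rewrite eqEsubv subvf -j_span; apply/subvP => x /Fadjoin_polyP[p /polyOverP pK ->].
  rewrite horner_coef; apply: rpred_sum => i _.
  have /vlineP[k ->] := pK i.
  by rewrite -scalerAl mul1r -rmorphXn rpredZ.
apply/freeP => k; rewrite big_ord_recl big_ord1 /= => k0.
have dn0 x : (fden x)%:F != 0 by rewrite tofrac_eq0 fden_neq0.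
have [] := @endo_basis_free (fnum (k i0) * fden (k i1)) (fnum (k i1) * fden (k i0)).
  have kE x : (fnum x)%:F = (fden x)%:F * x by rewrite {3}(fracE x) mulrC mulfVK.
  rewrite -[RHS](scaler0 _ ((fden (k i0))%:F * (fden (k i1))%:F)) -k0 scalerDr !scalerA.
  rewrite !tofracM !kE; congr (_ *: _ + _ *: _); first by rewrite mulrAC.
  by rewrite [LHS]mulrC mulrA.
move=> /eqP; rewrite mulf_eq0 (negPf (fden_neq0 _)) orbF => /eqP n0.
move=> /eqP; rewrite mulf_eq0 (negPf (fden_neq0 _)) orbF => /eqP n1.
move=> i; case: (unliftP ord0 i) => [i'|] ->; rewrite ?(ord1 i').
  by rewrite (fracE (k _)) n1 tofrac0 mul0r.
by rewrite (fracE (k _)) n0 tofrac0 mul0r.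
Qed.

(** The order is stable under multiplication by [u], so the matrix of this multiplication in the
    basis [alpha] has entries in A. *)
Lemma endo_trace_integral u : exists t : A, fext_trace (j u) = t%:F.
Proof.
have fe := basis_free endo_basis_of.
have tr_i (i : 'I_2) : exists t : A, coord e i (j u * e`_i) = t%:F.
  have -> : e`_i = j (alpha i).
    by case: (unliftP ord0 i) => [i'|] ->; rewrite ?(ord1 i').
  rewrite -rmorphM; have [a [b ->]] := endo_basis_coord (u * alpha i).
  have -> : j (alpha i0) = e`_i0 by [].
  have -> : j (alpha i1) = e`_i1 by [].
  rewrite linearD !linearZ /= (coord_free i0 i fe) (coord_free i1 i fe).
  case: (unliftP ord0 i) => [i'|] ->;
    rewrite ?(ord1 i') /= !(mulr0, mulr1, addr0, add0r).
    by exists b.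
  by exists a.
rewrite (fext_traceE _ endo_basis_of) big_ord_recl big_ord1.
have [t0 ->] := tr_i i0; have [t1 ->] := tr_i i1.
by exists (t0 + t1); rewrite tofracD.
Qed.

(* As Tr(1) = 2 is a unit, 1 and beta = Tr(alpha_1) alpha_0 - Tr(alpha_0) alpha_1
   again form a basis, up to the unit 2, and beta has trace 0. *)
Lemma endo_disc_sqr : (2%:R : Fq) != 0 ->
  exists (beta : endo_ring phi) (Delta : A),
    [/\ Delta%:F = endo_disc j alpha, beta ^+ 2 = endo_scalar phi Delta
      & forall a, Delta != a ^+ 2].
Proof.
move=> two; have [j_inj jA j_span] := j_gen.
have twoF : (2%:R : F) != 0.
  by rewrite -(rmorph_nat (@FracField.tofrac A)) tofrac_eq0 -polyCMn polyC_eq0.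
have eB := endo_basis_of.
have [t0 t0E] := endo_trace_integral (alpha i0).
have [t1 t1E] := endo_trace_integral (alpha i1).
have [m00 m00E] := endo_trace_integral (alpha i0 * alpha i0).
have [m01 m01E] := endo_trace_integral (alpha i0 * alpha i1).
have [m11 m11E] := endo_trace_integral (alpha i1 * alpha i1).
rewrite !rmorphM in m00E m01E m11E.
set x := j (alpha i0) in t0E m00E m01E *.
set y := j (alpha i1) in t1E m01E m11E *.
have [a [b]] := endo_basis_coord 1; rewrite rmorph1 -/x -/y => one.
have r0 : t0%:F = a%:F * m00%:F + b%:F * m01%:F.
  by rewrite -t0E -[x]mul1r {1}one mulrDl -!scalerAl (fext_traceD eB) !(fext_traceZ
    eB) m00E mulrC (mulrC y) m01E.
have r1 : t1%:F = a%:F * m01%:F + b%:F * m11%:F.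
  by rewrite -t1E -[y]mul1r {1}one mulrDl -!scalerAl (fext_traceD eB) !(fext_traceZ
    eB) m01E m11E.
have r2 : 2%:R = a%:F * t0%:F + b%:F * t1%:F.
  by rewrite -(fext_trace1 eB) one (fext_traceD eB) !(fext_traceZ eB) t0E t1E.
pose beta := endo_scalar phi t1 * alpha i0 - endo_scalar phi t0 * alpha i1.
have betaE : j beta = t1%:F *: x - t0%:F *: y.
  by rewrite /beta rmorphB !rmorphM !jA -!scalerAl !mul1r.
have beta_tr : fext_trace (j beta) = 0.
  by rewrite betaE (fext_traceB eB) !(fext_traceZ eB) t0E t1E mulrC subrr.
pose Delta := m00 * m11 - m01 * m01.
(* Let M be the Gram matrix of the trace form. Then t = M (a, b) by [r0] and [r1], hence Tr(beta^2)
   = t adj(M) t = det(M) (a t0 + b t1), which is 2 Delta by [r2]. *)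
have beta2 : j beta ^+ 2 = (Delta%:F)%:A.
  apply: (scalerI twoF); rewrite (sqr_fext_trace0 eB beta_tr) scalerA.
  congr (_ *: _); rewrite betaE.
  have -> : (t1%:F *: x - t0%:F *: y) ^+ 2 =
      (t1%:F ^+ 2) *: (x * x) + (t0%:F ^+ 2) *: (y * y)
      - (2%:R * t0%:F * t1%:F) *: (x * y).
    rewrite sqrrB !exprZn -scalerAl -scalerAr scalerA addrAC !expr2.
    by rewrite scalerMnl -[2%:R * _ * _]mulrA mulr_natl [t0%:F * _]mulrC.
  rewrite (fext_traceB eB) (fext_traceD eB) !(fext_traceZ eB) m00E m01E m11E.
  rewrite tofracB !tofracM.
  have -> : 2%:R * (m00%:F * m11%:F - m01%:F * m01%:F) =
     (a%:F * t0%:F + b%:F * t1%:F) * (m00%:F * m11%:F - m01%:F * m01%:F) by rewrite -r2.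
  by rewrite r0 r1 expr2; ring.
exists beta, Delta; split.
- rewrite /endo_disc (expand_det_row _ ord0) big_ord_recl big_ord1 /cofactor
    !det_mx11 !mxE /=.
  rewrite /= !expr0 !mul1r.
  have -> : lift (lift ord0 ord0) 0 = ord0 :> 'I_2 by apply: val_inj.
  have -> : lift (ord0 : 'I_2) 0 = lift ord0 ord0 :> 'I_2 by apply: val_inj.
  rewrite -/i0 -/i1 -/x -/y m00E m11E (mulrC y x) m01E tofracB !tofracM.
  by rewrite expr1 mulN1r mulrN.
- by apply: j_inj; rewrite rmorphXn /= jA beta2.
(* If Delta = c^2, then beta is c or -c in K; trace 0 forces beta = 0, hence t0 = t1 = 0 by
   freeness, against [r2]. *)
move=> c; apply/eqP => DE.
have sq0 : (j beta - (c%:F)%:A) * (j beta + (c%:F)%:A) = 0.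
  by rewrite -subr_sqr beta2 DE rmorphXn /= exprZn expr1n subrr.
have two0 z : 2%:R * z%:F = 0 -> (z%:F)%:A = 0 :> K.
  by move/eqP; rewrite mulf_eq0 (negPf twoF) => /eqP ->; rewrite scale0r.
have beta0 : j beta = 0.
  move/eqP: sq0; rewrite mulf_eq0 subr_eq0 addr_eq0 => /orP[] /eqP e1; rewrite e1.
    by apply: two0; rewrite mulrC -(fext_trace1 eB) -(fext_traceZ eB) -e1.
  by rewrite two0 ?oppr0 //; rewrite mulrC -(fext_trace1 eB) -(fext_traceZ eB) -[X
    in fext_trace X]opprK -e1 -[- _]scaleN1r (fext_traceZ eB) beta_tr mulr0.
have [] := @endo_basis_free t1 (- t0).
  by rewrite tofracN scaleNr -/x -/y -betaE.
move=> t10 /eqP; rewrite oppr_eq0 => /eqP t00.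
by move: r2; rewrite t10 t00 !tofrac0 !mulr0 addr0; apply/eqP.
Qed.
End EndoDisc.

(** * The commutation recursion and its solution *)

Section CommutationRecursion.
Variables (Fq : finFieldType) (L : fieldType).
Local Notation A := {poly Fq}.
Local Notation q := #|Fq|.
Variable gamma : {rmorphism A -> L}.

Lemma iter_frobq n (x : L) : iter n (frobq gamma) x = x ^+ (q ^ n).
Proof. by elim: n => [|n IH] /=; rewrite ?expr1 // IH /frobq -exprM expnSr. Qed.

(* The coefficient of tau^(k+1) in u f = f u, for f = f0 + f1 tau + f2 tau^2. *)
Definition comm_rel (f0 f1 f2 : L) (u : nat -> L) (k : nat) : Prop :=
  u k.+1 * (f0 ^+ (q ^ k.+1) - f0) =
    f1 * u k ^+ q - f1 ^+ (q ^ k) * u k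
    + (if k is k'.+1 then f2 * u k' ^+ (q ^ 2) - f2 ^+ (q ^ k') * u k' else 0).

(** The constant coefficients of u f and f u always agree, so only those of tau^(k+1) matter. There
    the two contributions of f0 combine to the factor f0^(q^(k+1)) - f0 of u_(k+1). *)
Lemma twist_comm_relP (f u : twist gamma) : (size f <= 3)%N ->
  u * f = f * u <-> forall k, comm_rel f`_0 f`_1 f`_2 (fun i => u`_i) k.
Proof.
move=> sf; pose C c : twist gamma := skewC (frobq gamma) c.
pose t : twist gamma := tau (frobq gamma).
have fE : f = C f`_0 * t ^+ 0 + C f`_1 * t ^+ 1 + C f`_2 * t ^+ 2.
  apply/polyP => k; rewrite !coefD !coef_MtauX /C /skewC !coefC.
  case: k => [|[|[|k]]]; rewrite ?addr0 ?add0r //=.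
  by rewrite nth_default // (leq_trans sf).
have coefR c n k : (u * (C c * t ^+ n))`_k =
    if (k < n)%N then 0 else u`_(k - n) * c ^+ (q ^ (k - n)).
  by rewrite mulrA coef_MtauX coef_skewMC iter_frobq.
have coefL c n k : (C c * t ^+ n * u)`_k =
    if (k < n)%N then 0 else c * u`_(k - n) ^+ (q ^ n).
  by rewrite -mulrA coef_skewCM coef_tauXM; case: ifP; rewrite ?mulr0 ?iter_frobq.
have eqB (a b c d : L) : a - b = c - d -> a = b <-> c = d.
  by move=> e; split=> /eqP; rewrite -subr_eq0 => h; apply/eqP; rewrite -subr_eq0;
    move: h; rewrite e.
have step k : (u * f)`_k.+1 = (f * u)`_k.+1 <->
    comm_rel f`_0 f`_1 f`_2 (fun i => u`_i) k.
  rewrite [in (u * f)]fE [in (f * u)]fE mulrDr mulrDr mulrDl mulrDl !coefD !coefR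
    !coefL.
  rewrite /comm_rel; case: k => [|k]; rewrite ?subSS ?subn0 /= ?expn0 ?expn1 ?expr1.
    by apply: eqB; ring.
  by apply: eqB; ring.
split=> [uf k|rel].
  by apply/step; rewrite uf.
apply/polyP => -[|k]; last by apply/step.
by rewrite !coef_skewM !big_ord1 /= mulrC.
Qed.
End CommutationRecursion.

Section Solution.
Variables (Fq : finFieldType) (L : fieldType).
Local Notation A := {poly Fq}.
Local Notation q := #|Fq|.
Variables (G1 G2 D : A) (h : nat).

(** This is Carlitz's bracket [k]; [sol_den] below is his D_k, the product of all monic polynomials
    of degree k. *)
Definition frob_gap (k : nat) : A := 'X^(q ^ k) - 'X.

Fixpoint sol_den (k : nat) : A :=
  if k is k'.+1 then frob_gap k * sol_den k' ^+ q else 1.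

(* The numerators of the solution with denominators sol_den, for psi_T rescaled
   to have coefficients G1, G2 in A; the powers of D come from
   s^q = s D^h and s^(q^2) = s D^(h (q+1)), where s^2 = D and q = 2h+1. *)
Fixpoint sol_num (k : nat) : A :=
  if k is k1.+1 then
    G1 * D ^+ h * sol_num k1 ^+ q
    - G1 ^+ (q ^ k1) * sol_den k1 ^+ q.-1 * sol_num k1
    + (if k1 is k2.+1 then
         frob_gap k1 ^+ q * (G2 * D ^+ (h * q.+1) * sol_num k2 ^+ (q ^ 2)
           - G2 ^+ (q ^ k2) * sol_den k2 ^+ (q ^ 2).-1 * sol_num k2)
       else 0)
  else 1.

Variables (gamma : {rmorphism A -> L}) (s eps f1 f2 : L).

(** The factor eps^(1 - q^k) undoes the conjugation by the constant eps that replaces f1, f2 by the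
    images of G1, G2; s is the prescribed constant term. *)
Definition sol (k : nat) : L :=
  s * gamma (sol_num k) / gamma (sol_den k) * eps / eps ^+ (q ^ k).

Lemma sol_den_neq0_le k m : (k <= m)%N ->
  gamma (sol_den m) != 0 -> gamma (sol_den k) != 0.
Proof.
move=> /subnK <-; elim: (m - k)%N => // i IH; rewrite addSn /= rmorphM rmorphXn.
rewrite mulf_eq0 negb_or => /andP[_ /eqP dq]; apply: IH; apply/eqP => d0.
apply: dq; rewrite d0 expr0n; case: eqP => // q0.
by have := finNzRing_gt1 Fq; rewrite q0.
Qed.

Lemma sol_den_neq0 m : (forall k, (0 < k <= m)%N -> gamma (frob_gap k) != 0) ->
  gamma (sol_den m) != 0.
Proof.
elim: m => [|m IH] gap; first by rewrite rmorph1 oner_neq0.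
rewrite /= rmorphM rmorphXn mulf_neq0 ?gap ?leqnn // expf_neq0 // IH // => k km.
by apply: gap; case/andP: km => -> /leqW ->.
Qed.

Hypotheses (qE : q = h.*2.+1) (s2 : s ^+ 2 = gamma D) (eps0 : eps != 0).
Hypotheses (f1E : f1 * eps ^+ q = gamma G1 * eps).
Hypotheses (f2E : f2 * eps ^+ (q ^ 2) = gamma G2 * eps).

Lemma sol0 : sol 0 = s.
Proof. by rewrite /sol /= !rmorph1 mulr1 divr1 expn0 expr1 mulfK. Qed.

(** The relation is first checked for the quotients [v] of numerators by denominators ([vrel]); s
    and eps are then put back by homogeneity. *)
Lemma comm_rel_sol k : gamma (sol_den k.+1) != 0 ->
  comm_rel Fq (gamma 'X) f1 f2 sol k.
Proof.
pose v i := gamma (sol_num i) / gamma (sol_den i).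
move=> den0.
have vrel : v k.+1 * gamma (frob_gap k.+1) =
    gamma G1 * gamma D ^+ h * v k ^+ q - gamma G1 ^+ (q ^ k) * v k
    + (if k is k'.+1 then gamma G2 * gamma D ^+ (h * q.+1) * v k' ^+ (q ^ 2)
         - gamma G2 ^+ (q ^ k') * v k' else 0).
  have q_gt0 : (0 < q)%N by rewrite qE.
  have q2_gt0 : (0 < q ^ 2)%N by rewrite expn_gt0 q_gt0.
  have den_k : gamma (sol_den k) != 0 by apply: sol_den_neq0_le den0.
  have gap0 : gamma (frob_gap k.+1) != 0.
    by move: den0; rewrite /= rmorphM mulf_eq0 negb_or => /andP[].
  rewrite /v [sol_den k.+1]/= [sol_num k.+1]/= [gamma (frob_gap k.+1 * _)]rmorphM.
  rewrite invfM [X in X * _]mulrA [LHS]mulrAC mulfVK // [gamma (sol_den k ^+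
    q)]rmorphXn.
  case: k den0 den_k {gap0} => [|k] den0 den_k.
    rewrite /= !addr0 !rmorphB !rmorphM !rmorphXn !rmorph1 !expr1n !invr1 !mulr1.
    by rewrite expr1n mulr1.
  have den_k' : gamma (sol_den k) != 0 by apply: sol_den_neq0_le den_k.
  (* This identity brings the two previous terms of the recursion to one denominator; it is the
     origin of the factor [frob_gap k1 ^+ q] in [sol_num]. *)
  have m1q : gamma (sol_den k.+1) ^+ q = gamma (frob_gap k.+1) ^+ q *
     (gamma (sol_den k) ^+ (q ^ 2)).
    by rewrite [sol_den k.+1]/= rmorphM rmorphXn exprMn -exprM.
  move: (sol_den k.+1) (sol_num k.+1) (sol_den k) (sol_num k) (frob_gap k.+1)
    den_k den_k' m1q {den0} => P1 Q1 P0 Q0 g den_k den_k'.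
  rewrite !(rmorphD, rmorphN, rmorphM, rmorphXn) /= !exprMn !exprVn.
  move: (gamma P1) den_k => m1 m10; move: (gamma P0) den_k' => m0 m00.
  move: (gamma Q1) (gamma Q0) (gamma g) => n1 n0 g1 m1q.
  have m1P : m1 ^+ q = m1 ^+ q.-1 * m1 by rewrite -exprSr prednK.
  have m0P : m0 ^+ (q ^ 2) = m0 ^+ (q ^ 2).-1 * m0 by rewrite -exprSr prednK.
  move: m1q; rewrite m1P m0P.
  have : m1 ^+ q.-1 != 0 by rewrite expf_neq0.
  have : m0 ^+ (q ^ 2).-1 != 0 by rewrite expf_neq0.
  move: (m1 ^+ q.-1) (m0 ^+ _) (g1 ^+ q) => M W g' W0 M0 ME.
  have g'E : g' = M * m1 / (W * m0) by rewrite ME mulfK // mulf_neq0.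
  rewrite g'E; move: (n1 ^+ q) (n0 ^+ _) (gamma G1 ^+ _) (gamma G2 ^+ _)
    (gamma D ^+ _) (gamma D ^+ _).
  move=> a1 a2 a3 a4 a5 a6; field.
  by rewrite W0 M0 m10 m00.
have solE i : sol i = s * v i * eps / eps ^+ (q ^ i) by rewrite /sol /v !mulrA.
have epsX n : eps ^+ n != 0 by rewrite expf_neq0.
have sq : s ^+ q = s * gamma D ^+ h by rewrite qE exprS -mul2n exprM s2.
have sqq : s ^+ (q ^ 2) = s * gamma D ^+ (h * q.+1).
  rewrite -mulnn exprM sq exprMn sq -mulrA -exprM -exprD; congr (_ * _ ^+ _).
  by rewrite mulnS.
have powE f G n i : f * eps ^+ n = gamma G * eps ->
    f ^+ i = gamma G ^+ i * eps ^+ i / eps ^+ (n * i).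
  by move=> fE; rewrite -exprMn -fE exprMn -exprM mulfK.
have solX i n : sol i ^+ n = s ^+ n * v i ^+ n * eps ^+ n / eps ^+ (q ^ i * n).
  by rewrite solE 3!exprMn exprVn -exprM.
have gapE : gamma 'X ^+ (q ^ k.+1) - gamma 'X = gamma (frob_gap k.+1).
  by rewrite rmorphB rmorphXn.
rewrite /comm_rel gapE [sol k.+1]solE.
have -> : s * v k.+1 * eps / eps ^+ (q ^ k.+1) * gamma (frob_gap k.+1) =
    s * eps / eps ^+ (q ^ k.+1) * (v k.+1 * gamma (frob_gap k.+1)).
  by move: (eps ^- _) => x; ring.
rewrite vrel solX sq (powE _ _ _ _ f1E) -expnS -expnSr [sol k]solE.
have f1E' : f1 = gamma G1 * eps / eps ^+ q by rewrite -f1E mulfK.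
have f2E' : f2 = gamma G2 * eps / eps ^+ (q ^ 2) by rewrite -f2E mulfK.
rewrite f1E'; case: k {den0 vrel gapE} => [|k].
  move: (epsX q) (epsX (q ^ 0)%N) (epsX (q ^ 1)%N).
  move: (eps ^+ q) (eps ^+ (q ^ 0)%N) (eps ^+ (q ^ 1)%N) (v 0%N ^+ q) (v 0%N).
  move: (gamma G1 ^+ _) (gamma D ^+ _) => a1 a2 x1 x2 x3 x4 x5 x10 x20 x30.
  by field; rewrite ?x10 ?x20 ?x30.
rewrite solX sqq (powE _ _ _ _ f2E) -!expnD addn2 add2n [sol k]solE f2E'.
move: (epsX q) (epsX (q ^ 2)%N) (epsX (q ^ k)%N) (epsX (q ^ k.+1)%N) (epsX (q ^
  k.+2)%N).
move: (eps ^+ q) (eps ^+ (q ^ 2)%N) (eps ^+ (q ^ k)%N) (eps ^+ (q ^ k.+1)%N)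
  (eps ^+ (q ^ k.+2)%N).
move: (v k) (v k ^+ _) (v k.+1) (v k.+1 ^+ _) (gamma G1 ^+ _) (gamma G2 ^+ _)
  (gamma D ^+ _) (gamma D ^+ _).
move=> b1 b2 b3 b4 b5 b6 b7 b8 x1 x2 x3 x4 x5 x10 x20 x30 x40 x50.
by field; rewrite x10 x20 x30 x40 x50.
Qed.
End Solution.

(** As long as f0^(q^(k+1)) - f0 is nonzero, [comm_rel] can be divided by it and determines the next
    coefficient from the two before it. *)
Lemma comm_rel_uniq (Fq : finFieldType) (L : fieldType) (f0 f1 f2 : L)
    (u w : nat -> L) (m : nat) :
  u 0%N = w 0%N ->
  (forall k, (k < m)%N -> f0 ^+ (#|Fq| ^ k.+1) != f0) ->
  (forall k, (k < m)%N -> comm_rel Fq f0 f1 f2 u k) ->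
  (forall k, (k < m)%N -> comm_rel Fq f0 f1 f2 w k) ->
  forall k, (k <= m)%N -> u k = w k.
Proof.
move=> uw0 f0m uP wP k; have [n] := ubnP k; elim: n k => // n IH [|k] //.
rewrite ltnS => kn km; have f0k : f0 ^+ (#|Fq| ^ k.+1) - f0 != 0 by rewrite
  subr_eq0 f0m.
apply: (mulIf f0k); rewrite (uP _ km) (wP _ km) (IH k) ?(ltnW km) //.
by case: k kn km {f0k} => // k kn km; rewrite (IH k) // ltnW // ltnW.
Qed.

(** * Degrees of the numerators and denominators *)

Section Degree.
Variable Fq : finFieldType.
Local Notation A := {poly Fq}.
Local Notation q := #|Fq|.

Definition deg (x : A) : nat := (size x).-1.
Local Arguments deg x%_R.

Lemma degM_le (x y : A) : (deg (x * y) <= deg x + deg y)%N.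
Proof.
rewrite /deg; have [->|x0] := eqVneq x 0; first by rewrite mul0r size_poly0.
have [->|y0] := eqVneq y 0; first by rewrite mulr0 size_poly0.
rewrite size_mul //; move: x0 y0; rewrite -!size_poly_gt0.
by case: (size x) (size y) => [|a] [|b] //=; rewrite addnS.
Qed.

Lemma degX_le (x : A) n : (deg (x ^+ n) <= n * deg x)%N.
Proof.
rewrite /deg; have := size_poly_exp_leq x n; rewrite mulnC.
by case: (size _) => // a; rewrite ltnS.
Qed.

Lemma degN (x : A) : deg (- x) = deg x.
Proof. by rewrite /deg size_polyN. Qed.

Lemma degD_le (x y : A) m : (deg x <= m -> deg y <= m -> deg (x + y) <= m)%N.
Proof.
rewrite /deg => xm ym; have := size_polyD x y;
  rewrite -!subn1 !leq_subLR !add1n in xm ym *.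
by move/leq_trans; apply; rewrite geq_max xm ym.
Qed.

Lemma degB_le (x y : A) m : (deg x <= m -> deg y <= m -> deg (x - y) <= m)%N.
Proof. by move=> xm ym; apply: degD_le; rewrite ?degN. Qed.

Lemma deg_frob_gap k : (deg (frob_gap Fq k) <= q ^ k)%N.
Proof.
apply: degB_le; rewrite /deg ?size_polyXn // size_polyX /= expn_gt0.
by rewrite (ltnW (finNzRing_gt1 Fq)).
Qed.

Lemma deg_sol_den k : (deg (sol_den Fq k) <= k * q ^ k)%N.
Proof.
elim: k => [|k IH]; first by rewrite /deg size_poly1.
rewrite /= mulSn; apply: leq_trans (degM_le _ _) _; apply: leq_add.
  exact: deg_frob_gap.
by apply: leq_trans (degX_le _ _) _; rewrite expnS mulnCA leq_mul2l IH orbT.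
Qed.

Variables (G1 G2 D : A) (h c : nat).
Hypothesis qE : q = h.*2.+1.
Hypotheses (G1c : (deg G1 <= c)%N) (G2c : (deg G2 <= c)%N).

(** Strengthening the bound by deg D on the left makes the induction close: the power D^h is
    absorbed through h d + d <= q d, and similarly for the q^2 term. The slope c + 2 leaves room for
    G1, G2, the powers of [sol_den] and [frob_gap]. *)
Lemma deg_sol_num k :
  (deg (sol_num G1 G2 D h k) + deg D
    <= q ^ k * ((c + 2) * k + deg D))%N.
Proof.
set d := deg D; set N := sol_num G1 G2 D h.
have q_gt1 := finNzRing_gt1 Fq; have q_gt0 := ltnW q_gt1.
have [n] := ubnP k; elim: n k => // n IHn m; rewrite ltnS => mn.
have IH i : (i < m)%N -> (deg (N i) + d <= q ^ i * ((c + 2) * i + d))%N.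
  by move=> im; apply: IHn; exact: leq_trans im mn.
case: m IH {mn IHn} => [|m] IH; first by rewrite /N /= /deg size_poly1 expn0 mul1n muln0.
(* [degD_le] needs a bound on the bare degree, so d moves to the right; since d <= B, nothing is
   lost by truncated subtraction. *)
set B := (_ * _)%N; suff : (deg (N m.+1) <= B - d)%N.
  rewrite -(leq_add2r d) subnK //.
  rewrite /B; apply: leq_trans (leq_pmull _ _); first exact: leq_addl.
  by rewrite expn_gt0 q_gt0.
have dB x : (x + d <= B -> x <= B - d)%N by move=> xB;
  rewrite -(leq_add2r d) subnK // (leq_trans _ xB) ?leq_addl.
have qm_gt0 i : (0 < q ^ i)%N by rewrite expn_gt0 q_gt0.
have IHm := IH m (ltnSn _).
have T1 : (deg (G1 * D ^+ h * N m ^+ q) + d <= B)%N.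
  have := degM_le (G1 * D ^+ h) (N m ^+ q); have := degM_le G1 (D ^+ h).
  have := degX_le D h; have := degX_le (N m) q; rewrite -/d => e1 e2 e3 e4.
  have e5 : (q * (deg (N m) + d) <= q * (q ^ m * ((c + 2) * m + d)))%N
    by rewrite leq_mul2l IHm orbT.
  move: e5; rewrite mulnA -expnS => e5.
  have -> : (B = q ^ m.+1 * ((c + 2) * m + d) + q ^ m.+1 * (c + 2))%N
    by rewrite /B; lia.
  have e6 : (h * d + d <= q * d)%N by rewrite qE; nia.
  have : (c <= q ^ m.+1 * (c + 2))%N by rewrite (leq_trans (leq_addr 2 c)) // leq_pmull.
  lia.
have T2 : (deg (G1 ^+ (q ^ m) * sol_den Fq m ^+ q.-1 * N m) + d <= B)%N.
  have := degM_le (G1 ^+ (q ^ m) * sol_den Fq m ^+ q.-1) (N m).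
  have := degM_le (G1 ^+ (q ^ m)) (sol_den Fq m ^+ q.-1).
  have := degX_le G1 (q ^ m); have := degX_le (sol_den Fq m) q.-1.
  have := deg_sol_den m.
  have : (q ^ m * deg G1 <= q ^ m * c)%N by rewrite leq_mul2l G1c orbT.
  move=> e0 e1 e2 e3 e4 e5.
  have e6 : (q.-1 * deg (sol_den Fq m) <= q.-1 * (m * q ^ m))%N
    by rewrite leq_mul2l e1 orbT.
  have : (q ^ m * c + q.-1 * (m * q ^ m) + q ^ m * ((c + 2) * m + d) <= B)%N.
    rewrite /B expnS; move: (q ^ m)%N => Q; rewrite [(q * Q)%N]mulnC -mulnA.
    have -> : (Q * c + q.-1 * (m * Q) + Q * ((c + 2) * m + d) =
       Q * (c + q.-1 * m + ((c + 2) * m + d)))%N by ring.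
    rewrite leq_mul2l; apply/orP; right; move: q_gt1; case: q => // r r_gt0 /=.
    nia.
  lia.
rewrite [N m.+1]/= -/N; apply: degD_le; first by apply: degB_le; apply: dB.
case: m IH IHm {T1 T2} @B dB => [|m] IH IHm B dB; first by rewrite /deg size_poly0.
have IHm' := IH m (ltnW (ltnSn _)).
have BE : (B = q ^ m.+2 * ((c + 2) * m + d) + q ^ m.+2 * (2 * (c + 2)))%N
  by rewrite /B; lia.
have aux r : (0 < r)%N -> (c + r.-1 * m + ((c + 2) * m + d) <=
    r * ((c + 2) * m + d) + r * c)%N.
  by case: r => // r _ /=; nia.
(* A bound for the bracket alone, which leaves within B - d the q^(m+2) needed for the factor
   [frob_gap m.+1 ^+ q]. *)
pose B' := (q ^ m.+2 * ((c + 2) * m + d) + q ^ m.+2 * c - d)%N.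
have q2E : (q ^ m.+2 = q ^ 2 * q ^ m)%N by rewrite -expnD.
have dB' : (d <= q ^ m.+2 * ((c + 2) * m + d))%N.
  by apply: leq_trans (leq_pmull _ (qm_gt0 m.+2)); exact: leq_addl.
have T3 : (deg (G2 * D ^+ (h * q.+1) * N m ^+ (q ^ 2)) <= B')%N.
  have := degM_le (G2 * D ^+ (h * q.+1)) (N m ^+ (q ^ 2));
    have := degM_le G2 (D ^+ (h * q.+1)).
  have := degX_le D (h * q.+1); have := degX_le (N m) (q ^ 2);
    rewrite -/d => e1 e2 e3 e4.
  have e5 : (q ^ 2 * (deg (N m) + d) <= q ^ 2 * (q ^ m * ((c + 2) * m + d)))%N
    by rewrite leq_mul2l IHm' orbT.
  move: e5; rewrite mulnA -q2E => e5.
  have e6 : (h * q.+1 * d + d <= q ^ 2 * d)%N by rewrite qE; nia.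
  have : (c <= q ^ m.+2 * c)%N by rewrite leq_pmull.
  rewrite /B'; lia.
have T4 : (deg (G2 ^+ (q ^ m) * sol_den Fq m ^+ (q ^ 2).-1 * N m) <= B')%N.
  have := degM_le (G2 ^+ (q ^ m) * sol_den Fq m ^+ (q ^ 2).-1) (N m).
  have := degM_le (G2 ^+ (q ^ m)) (sol_den Fq m ^+ (q ^ 2).-1).
  have := degX_le G2 (q ^ m); have := degX_le (sol_den Fq m) (q ^ 2).-1.
  have := deg_sol_den m.
  have : (q ^ m * deg G2 <= q ^ m * c)%N by rewrite leq_mul2l G2c orbT.
  move=> e0 e1 e2 e3 e4 e5.
  have e6 : ((q ^ 2).-1 * deg (sol_den Fq m) <= (q ^ 2).-1 * (m * q ^ m))%N
    by rewrite leq_mul2l e1 orbT.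
  have : (q ^ m * c + (q ^ 2).-1 * (m * q ^ m) + q ^ m * ((c + 2) * m + d) <=
     q ^ m.+2 * ((c + 2) * m + d) + q ^ m.+2 * c)%N.
    rewrite q2E; move: (q ^ m)%N => Q;
      rewrite [(q ^ 2 * Q)%N]mulnC -![(Q * _ * _)%N]mulnA -mulnDr.
    have -> : (Q * c + (q ^ 2).-1 * (m * Q) + Q * ((c + 2) * m + d) =
       Q * (c + (q ^ 2).-1 * m + ((c + 2) * m + d)))%N by ring.
    rewrite leq_mul2l; apply/orP; right.
    exact: aux (qm_gt0 2%N).
  rewrite /B'; lia.
apply: leq_trans (degM_le _ _) _.
have gq : (deg (frob_gap Fq m.+1 ^+ q) <= q ^ m.+2)%N.
  by apply: leq_trans (degX_le _ _) _;
    rewrite [(q ^ m.+2)%N]expnS leq_mul2l deg_frob_gap orbT.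
have := degB_le T3 T4; move: gq dB'; rewrite BE /B'.
move: (q ^ m.+2 * ((c + 2) * m + d))%N (q ^ m.+2)%N (deg _) (deg _).
by move=> X Q x y; lia.
Qed.
End Degree.

(** * Twisted polynomials and reduction *)

Lemma comm_rel_ext (Fq : finFieldType) (L : fieldType) (f0 f1 f2 : L)
    (u w : nat -> L) (k : nat) :
  (forall i, (i <= k.+1)%N -> u i = w i) ->
  comm_rel Fq f0 f1 f2 u k -> comm_rel Fq f0 f1 f2 w k.
Proof.
rewrite /comm_rel => uw; rewrite (uw _ (leqnn _)) (uw k (leqnSn k)).
by case: k uw => [|k] uw //; rewrite (uw k (ltnW (leqnSn k.+1))).
Qed.

Section TwistFacts.
Variables (Fq : finFieldType) (L : fieldType).
Local Notation A := {poly Fq}.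
Local Notation q := #|Fq|.
Variable gamma : {rmorphism A -> L}.

Lemma coef0_twistM (u v : twist gamma) : (u * v)`_0 = u`_0 * v`_0.
Proof. by rewrite coef_skewM big_ord1. Qed.

Lemma size_twistM (u v : twist gamma) : (size (u * v)%R <= (size u + size v).-1)%N.
Proof. exact: size_poly. Qed.

(** If l is the leading coefficient and s the tau-degree of u, the coefficient of tau^(2s) in u^2 is
    l * l^(q^s), which is nonzero. *)
Lemma size_twist_sqr (u : twist gamma) : u != 0 ->
  ((size u).-1.*2 < size (u * u)%R)%N.
Proof.
move=> u0; set s := (size u).-1; rewrite ltnNge; apply/negP => us.
have ls : u`_s != 0 by rewrite -lead_coefE lead_coef_eq0.
have : (u * u)`_(s.*2) = 0 by rewrite nth_default.
have ss : (s < s.*2.+1)%N by rewrite ltnS -addnn leq_addl.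
rewrite coef_skewM (bigD1 (Ordinal ss)) //= big1 => [|i /eqP ne_i].
  rewrite addr0 -addnn addnK iter_frobq; apply/eqP.
  by rewrite mulf_neq0 ?expf_neq0.
have [si|is_] := ltnP s i.
  rewrite [u`_i]nth_default ?mul0r //.
  by apply: leq_trans si; rewrite /s; case: (size u).
have {}is_ : (i < s)%N by rewrite ltn_neqAle is_ andbT;
  apply: contra_notN ne_i => /eqP e; apply: val_inj.
rewrite [u`_(_ - _)]nth_default ?iter_sigma0 ?mulr0 //.
have : (size u <= s.+1)%N by rewrite /s; case: (size u).
by move/leq_trans; apply; rewrite ltn_subRL -[ltnRHS]addnn ltn_add2r.
Qed.

(** Horner induction: constants from F_q commute with everything, so commuting with the image of T
    suffices. Here [phi] is a mere function because [base_change] is one. *)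
Lemma mem_endo_gen (phi : A -> twist gamma) (u : twist gamma) :
  phi 0 = 0 ->
  (forall a c, phi (a * 'X + c%:P) =
     phi a * phi 'X + skewC (frobq gamma) (gamma c%:P)) ->
  u * phi 'X = phi 'X * u -> u \in endo phi.
Proof.
move=> phi0 phiS uX; apply/endoP; elim/poly_ind => [|a c IH].
  by rewrite phi0 mulr0 mul0r.
rewrite phiS mulrDr mulrDl mulrA IH -!mulrA uX; congr (_ + _).
exact: skewC_gamma_comm.
Qed.

Section Drinfeld.
Variables (r : nat) (phi : {rmorphism A -> twist gamma}).
Hypothesis phiD : is_drinfeld r phi.

Lemma drinfeld_step a c :
  phi (a * 'X + c%:P) = phi a * phi 'X + skewC (frobq gamma) (gamma c%:P).
Proof. by case: phiD => _ phiC _ _; rewrite rmorphD rmorphM /= phiC. Qed.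

Lemma drinfeld_coef0 a : (phi a)`_0 = gamma a.
Proof.
elim/poly_ind: a => [|a c IH]; first by rewrite !rmorph0 coef0.
case: phiD => _ _ phiX _.
by rewrite drinfeld_step coefD coef0_twistM IH phiX coefC rmorphD rmorphM.
Qed.

Lemma size_drinfeld a : (size (phi a) <= (r * (size a).-1).+1)%N.
Proof.
have size0 : size (0 : twist gamma) = 0%N by exact: size_poly0.
elim/poly_ind: a => [|a c IH]; first by rewrite rmorph0 size0.
case: phiD => _ phiC _ sX; rewrite drinfeld_step.
have [->|a0] := eqVneq a 0.
  rewrite rmorph0 mul0r add0r; apply: leq_trans (size_polyC_leq1 (gamma c%:P)) _.
  by rewrite ltnS.
rewrite size_MXaddC (negPf a0) /=; apply: leq_trans (size_polyD _ _) _.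
rewrite geq_max; apply/andP; split; last first.
  by apply: leq_trans (size_polyC_leq1 (gamma c%:P)) _.
apply: leq_trans (size_twistM _ _) _; rewrite sX addnS /= addnC.
move: a0 IH; rewrite -size_poly_gt0; case: (size a) => // n _ /=; rewrite mulnS => IH.
by rewrite -addnS leq_add2l.
Qed.
End Drinfeld.
End TwistFacts.

Section BaseChangeFacts.
Variables (Fq : finFieldType) (L L' : fieldType).
Local Notation A := {poly Fq}.
Variables (gamma : {rmorphism A -> L}) (iota : {rmorphism L -> L'}).
Variables (r : nat) (phi : {rmorphism A -> twist gamma}).
Hypothesis phiD : is_drinfeld r phi.

Lemma base_change_step a c :
  base_change iota phi (a * 'X + c%:P) =
  base_change iota phi a * base_change iota phi 'X
  + skewC (frobq (iota \o gamma)) ((iota \o gamma) c%:P).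
Proof.
rewrite /base_change (drinfeld_step phiD); apply/polyP => k.
rewrite coef_map /= !coefD rmorphD !coefC; congr (_ + _); last first.
  by case: ifP; rewrite ?rmorph0.
rewrite !coef_skewM rmorph_sum; apply: eq_bigr => i _.
by rewrite rmorphM !coef_map !iter_frobq rmorphXn.
Qed.

Lemma mem_endo_base_change (u : twist (iota \o gamma)) :
  u * base_change iota phi 'X = base_change iota phi 'X * u ->
  u \in endo (base_change iota phi).
Proof.
by apply: mem_endo_gen base_change_step; rewrite /base_change !rmorph0.
Qed.
End BaseChangeFacts.

Section ResidueFacts.
Variables (Fq : finFieldType) (p : {poly Fq}) (mi : monic_irreducible_poly p).

(** In lowest terms, a p dividing the denominator does not divide the numerator, which makes the
    order negative. *)
Lemma fden_integral x : (0%:E <= pord p x)%E -> ~~ (p %| fden x).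
Proof.
have [[p1 _] _] := mi => px; apply/negP => pd.
have pn : ~~ (p %| fnum x).
  apply/negP => pn; have : p %| gcdp (fnum x) (fden x) by rewrite dvdp_gcd pn.
  have /eqp_dvdr -> : gcdp (fnum x) (fden x) %= 1.
    by rewrite -size_poly_eq1; exact: fnum_fden_coprime.
  by rewrite dvdp1 gtn_eqF.
have n0 : fnum x != 0 by apply: contraNneq pn => ->; exact: dvdp0.
move: px; rewrite /pord; case: eqP => [x0|_].
  by move: n0; have := fracE x; rewrite x0 => /esym/eqP;
    rewrite mulf_eq0 invr_eq0 !tofrac_eq0 (negPf (fden_neq0 _)) orbF => ->.
rewrite lee_fin; have := pmult_eq0 mi n0; rewrite pn => /eqP ->.
rewrite sub0r oppr_ge0 lez_nat leqn0.
by rewrite pmult_eq0 ?fden_neq0 // pd.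
Qed.

Lemma residue_surj (y : {poly %/ p with mi}) : exists a, y = residue mi a.
Proof.
exists (val y); apply: val_inj; apply: esym; apply: in_qpoly_small.
exact: size_mk_monic.
Qed.

(** If the q^k-power map fixed the class of T, it would fix all of A/p, and X^(q^k) - X would have
    q^(deg p) > q^k roots. *)
Lemma residue_frob_gap_neq0 k : (0 < k < (size p).-1)%N ->
  residue mi (frob_gap Fq k) != 0.
Proof.
move=> /andP[k0 kp]; apply/eqP; rewrite /frob_gap rmorphB rmorphXn => /eqP.
rewrite subr_eq0 => /eqP X_fix.
have fixed (y : {poly %/ p with mi}) : y ^+ (#|Fq| ^ k) = y.
  have [a ->] := residue_surj y; rewrite -(iter_frobq (residue mi)).
  elim/poly_ind: a => [|a c IH]; first by rewrite rmorph0 iter_sigma0.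
  rewrite rmorphD rmorphM iter_sigmaD iter_sigmaM IH !iter_frobq X_fix.
  congr (_ + _); elim: k {k0 kp X_fix IH} => [|k IH]; first by rewrite expr1.
  by rewrite expnSr exprM IH -rmorphXn -polyC_exp expf_card.
have q1 := finNzRing_gt1 Fq.
have qk : (1 < #|Fq| ^ k)%N by rewrite -(exp1n k) ltn_exp2r.
pose Q : {poly {poly %/ p with mi}} := 'X^(#|Fq| ^ k) - 'X.
have sQ : size Q = (#|Fq| ^ k).+1.
  by rewrite size_polyDl size_polyXn // size_polyN size_polyX.
have Q0 : Q != 0 by rewrite -size_poly_eq0 sQ.
have rootsQ : all (root Q) (enum {: {poly %/ p with mi}}).
  by apply/allP => y _; rewrite rootE /Q !hornerE fixed subrr.
have := max_poly_roots Q0 rootsQ (enum_uniq _).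
by rewrite -cardE card_qfpoly sQ ltnS leqNgt ltn_exp2l // kp.
Qed.
End ResidueFacts.

(** * The bound on deg p in terms of the discriminant *)

Section RankTwo.
Variables (Fq : finFieldType).
Local Notation A := {poly Fq}.
Local Notation q := #|Fq|.
Local Notation "x %:F" := (@FracField.tofrac {poly Fq} x).

Lemma odd_card2_neq0 : odd q -> (2%:R : Fq) != 0.
Proof.
move=> q_odd; apply/eqP => two0.
have ch2 : 2 \in [pchar Fq] by rewrite inE /= two0 eqxx.
have := fin_ring_pchar_abelem ch2 => /abelem_pgroup.
rewrite /pgroup cardsT => /p_natP[k qk]; have := finNzRing_gt1 Fq.
by move: q_odd; rewrite qk oddX orbF => /eqP ->.
Qed.

Variables (psi : {rmorphism A -> twist (@FracField.tofrac {poly Fq})}).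
Hypothesis psi_rank2 : is_drinfeld 2 psi.
Let g1 := (psi 'X)`_1.
Let g2 := (psi 'X)`_2.
(** Conjugating psi_T by e turns g1, g2 into g1 e^(q-1) and g2 e^(q^2-1); [G1] and [G2] are these
    elements, written so that they visibly lie in A. *)
Let e : A := fden g1 * fden g2.
Let G1 : A := fnum g1 * fden g2 * e ^+ q.-2.
Let G2 : A := fnum g2 * fden g1 * e ^+ (q ^ 2).-2.

Let e_neq0 : e != 0.
Proof. by rewrite mulf_neq0 ?fden_neq0. Qed.

Lemma clear_denominators (L : fieldType) (gamma : {rmorphism A -> L})
    (n d d' : A) (m : nat) :
  (1 < m)%N -> gamma d != 0 ->
  gamma n / gamma d * gamma (d * d') ^+ m =
    gamma (n * d' * (d * d') ^+ m.-2) * gamma (d * d').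
Proof.
case: m => [|[|m]] //= _ d0; rewrite !rmorphM rmorphXn !rmorphM !exprS.
by move: (_ ^+ m) => x; field.
Qed.

Let qE : odd q -> q = (q./2).*2.+1.
Proof. by move=> q_odd; rewrite -[LHS]odd_double_half q_odd. Qed.

Let q2_gt1 : (1 < q ^ 2)%N.
Proof. by rewrite -(exp1n 2) ltn_exp2r // finNzRing_gt1. Qed.

(** The recursion looks back two steps, so after two consecutive zeros the solution can be cut off
    and still commutes with psi_T. *)
Lemma sol_num_neq0 (q_odd : odd q) (Falg : closedFieldType)
    (iota : {rmorphism {fraction A} -> Falg}) (D : A) (d : nat) :
  (forall u : twist (iota \o @FracField.tofrac A),
     u \in endo (base_change iota psi) -> exists a, u = base_change iota psi a) ->
  (forall a, D != a ^+ 2) ->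
  sol_num G1 G2 D q./2 d.+1 != 0 \/ sol_num G1 G2 D q./2 d.+2 != 0.
Proof.
move=> End_psi nsq; set N := sol_num G1 G2 D q./2.
have [N1|] := eqVneq (N d.+1) 0; last by left.
have [N2|] := eqVneq (N d.+2) 0; last by right.
pose gamma : {rmorphism A -> Falg} := iota \o @FracField.tofrac A.
have gamma_neq0 a : a != 0 -> gamma a != 0.
  by move=> a0; rewrite /gamma /= fmorph_eq0 tofrac_eq0.
have [s] := solve_monicpoly (fun i => if i == 0%N then gamma D else 0) (isT :
  (0 < 2)%N).
rewrite big_ord_recl big_ord1 /= mul0r addr0 expr0 mulr1 => s2.
pose w := sol G1 G2 D q./2 gamma s (gamma e).
have e0 : gamma e != 0 by rewrite gamma_neq0.
have gX : (psi 'X)`_0 = 'X%:F by case: psi_rank2.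
have f1E : iota g1 * gamma e ^+ q = gamma G1 * gamma e.
  rewrite (fracE g1) fmorph_div; apply: (@clear_denominators _ gamma).
    exact: finNzRing_gt1.
  by rewrite gamma_neq0 // fden_neq0.
have f2E : iota g2 * gamma e ^+ (q ^ 2) = gamma G2 * gamma e.
  rewrite (fracE g2) fmorph_div /G2 /e [fden g1 * _]mulrC.
  apply: (@clear_denominators _ gamma) => //.
  by rewrite gamma_neq0 // fden_neq0.
have den0 m : gamma (sol_den Fq m) != 0.
  apply: sol_den_neq0 => k /andP[k0 _]; apply: gamma_neq0.
  rewrite -size_poly_eq0 size_polyDl size_polyXn // size_polyN size_polyX.
  have qk : (1 < q ^ k)%N by rewrite -(exp1n k) ltn_exp2r // finNzRing_gt1.
  exact: qk.
have w_rel k : comm_rel Fq (gamma 'X) (iota g1) (iota g2) w k.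
  by apply: comm_rel_sol => //; apply: qE.
have w0 k : (d < k <= d.+2)%N -> w k = 0.
  rewrite /w /sol -/N => kd.
  have -> : N k = 0.
    have [->//|/eqP ne] := eqVneq k d.+2.
    by have -> : k = d.+1 by lia.
  by rewrite rmorph0 mulr0 !mul0r.
pose U : twist gamma := \poly_(i < d.+1) w i.
have Uw k : (k <= d.+2)%N -> U`_k = w k.
  move=> kd; rewrite coef_poly ltnS; case: leqP => // dk.
  by rewrite w0 // dk.
have U_endo : U \in endo (base_change iota psi).
  apply: (mem_endo_base_change psi_rank2); apply/twist_comm_relP => [|k].
    by rewrite size_map_poly; case: psi_rank2 => _ _ _ ->.
  (* For k < d+2 the relation involves only indices up to d+2, where U agrees with w. For larger k
     all its indices exceed d and every term vanishes. *)
  rewrite !coef_map gX -/g1 -/g2; have [kd|dk] := ltnP k d.+2.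
    apply: (@comm_rel_ext _ _ _ _ _ w); last exact: w_rel.
    by move=> i ik; rewrite Uw // (leq_trans ik).
  have U0 i : (d < i)%N -> U`_i = 0.
    by move=> di; rewrite coef_poly ltnS leqNgt di.
  have q0 : (0 < q)%N by exact: ltnW (finNzRing_gt1 Fq).
  have U1 : U`_k.+1 = 0 by apply: U0; lia.
  have U2 : U`_k = 0 by apply: U0; lia.
  have zX (n : nat) : (0 < n)%N -> 0 ^+ n = 0 :> Falg by case: n => // n _;
    rewrite expr0n.
  rewrite /comm_rel U1 U2 mul0r (zX _ q0) !mulr0 subrr add0r.
  case: k dk {U1 U2} => // k dk; have -> : U`_k = 0 by apply: U0.
  by rewrite zX ?mulr0 ?subrr // expn_gt0 q0.
have [a Ua] := End_psi U U_endo.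
have s_a : s = gamma a.
  have := congr1 (fun v : twist gamma => v`_0) Ua.
  rewrite /base_change coef_map (drinfeld_coef0 psi_rank2) /= Uw // /w sol0 //.
have := nsq a; rewrite -subr_eq0 => /gamma_neq0.
by rewrite rmorphB rmorphXn -s_a s2 subrr eqxx.
Qed.

Lemma deg_prime_le (q_odd : odd q) (Falg : closedFieldType)
    (iota : {rmorphism {fraction A} -> Falg}) :
  (forall u : twist (iota \o @FracField.tofrac A),
     u \in endo (base_change iota psi) -> exists a, u = base_change iota psi a) ->
  exists2 B : nat, (0 < B)%N &
    forall (p : A) (mi : monic_irreducible_poly p), good_reduction p psi ->
    forall (D : A) (u : twist (residue mi)),
      u \in endo (reduction mi psi) -> u ^+ 2 = reduction mi psi D ->
      (forall a, D != a ^+ 2) ->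
    ((size p).-1 <= B * (size D) * q ^ (size D).-1)%N.
Proof.
move=> End_psi; pose c := maxn (deg G1) (deg G2).
(* For k <= d+2, q^k <= q^2 q^d and (c+2) k + d <= (2c+5)(d+1); c depends only on q and psi. *)
exists (q ^ 2 * (2 * c + 5))%N.
  by rewrite muln_gt0 expn_gt0 (ltnW (finNzRing_gt1 Fq)) addnS.
move=> p mi good D u uE u2 nsq.
have D0 : D != 0 by have := nsq 0; rewrite expr0n.
set d := (size D).-1; have dE : size D = d.+1 by rewrite prednK ?size_poly_gt0.
rewrite dE; set n := (size p).-1.
have q_gt1 := finNzRing_gt1 Fq; have q_gt0 := ltnW q_gt1.
have bound k : (k <= d.+2)%N ->
    (q ^ k * ((c + 2) * k + d) <= q ^ 2 * (2 * c + 5) * d.+1 * q ^ d)%N.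
  move=> kd; have qk : (q ^ k <= q ^ 2 * q ^ d)%N by rewrite -expnD leq_exp2l.
  have e1 : ((c + 2) * k + d <= (2 * c + 5) * d.+1)%N.
    by have := leq_mul (leqnn (c + 2)) kd; nia.
  apply: leq_trans (leq_mul qk e1) _.
  by move: (q ^ 2)%N (q ^ d)%N => x y; apply: eq_leq; ring.
(* If deg p <= d+2 the bound is trivial; otherwise every [frob_gap] up to index d+2 is invertible
   modulo p. *)
have [nd|dn] := leqP n d.+2.
  apply: leq_trans nd _; apply: leq_trans (leq_pmulr _ _);
    last by rewrite expn_gt0 q_gt0.
  apply: (@leq_trans (5 * d.+1)); first by lia.
  rewrite leq_mul2r; apply/orP; right.
  apply: leq_trans (leq_pmull _ _); last by rewrite expn_gt0 q_gt0.
  by rewrite leq_addl.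
have phiD := reduction_drinfeld mi psi_rank2 good.
set phi := reduction mi psi in uE u2 phiD.
have [good1 good2] := good.
have pd1 : residue mi (fden g1) != 0 by rewrite residue_eq0 fden_integral.
have pd2 : residue mi (fden g2) != 0 by rewrite residue_eq0 fden_integral // good2.
have fres0 : fresidue mi 0 = 0 by rewrite -tofrac0 fresidue_tofrac rmorph0.
have phiX : phi 'X = map_poly (fresidue mi) (psi 'X) by exact: horner_morphX.
have phi1 : (phi 'X)`_1 = residue mi (fnum g1) / residue mi (fden g1).
  by rewrite phiX coef_map_id0.
have phi2 : (phi 'X)`_2 = residue mi (fnum g2) / residue mi (fden g2).
  by rewrite phiX coef_map_id0.
have phi0 : (phi 'X)`_0 = residue mi 'X by case: phiD.
have u_rel : forall k, comm_rel Fq (residue mi 'X) (phi 'X)`_1 (phi 'X)`_2 (fun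
  i => u`_i) k.
  rewrite -phi0; apply/twist_comm_relP; first by case: phiD => _ _ _ ->.
  by move/endoP: uE; apply.
have s2 : u`_0 ^+ 2 = residue mi D.
  by rewrite -(drinfeld_coef0 phiD) -u2 !expr2 coef0_twistM.
(* D is nonzero of degree d < deg p, so it does not vanish modulo p. *)
have u00 : u`_0 != 0.
  rewrite -sqrf_eq0 s2 residue_eq0; apply/negP => /dvdp_leq -/(_ D0).
  rewrite dE => pD; suff : (n <= d)%N by move: dn; lia.
  by rewrite /n; case: (size p) pD.
have u_neq0 : u != 0 by apply: contraNneq u00 => ->; apply/eqP; exact: coef0.
(* u^2 is the image of D and has tau-degree at most 2d in rank 2, so u has tau-degree at most d. *)
have u_hi k : (d < k)%N -> u`_k = 0.
  move=> dk; apply: nth_default; have := size_twist_sqr u_neq0.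
  rewrite -expr2 u2 => /leq_trans/(_ (size_drinfeld phiD D)); rewrite -/d.
  by move: dk; case: (size u) => // su; lia.
pose w := sol G1 G2 D q./2 (residue mi) u`_0 (residue mi e).
have e0 : residue mi e != 0 by rewrite rmorphM mulf_neq0.
have gap0 k : (0 < k <= d.+2)%N -> residue mi (frob_gap Fq k) != 0.
  by move=> /andP[k0 kd]; apply: residue_frob_gap_neq0; rewrite k0 (leq_ltn_trans kd).
have den0 k : (k <= d.+2)%N -> residue mi (sol_den Fq k) != 0.
  move=> kd; apply: sol_den_neq0 => i /andP[i0 ik]; apply: gap0.
  by rewrite i0 (leq_trans ik).
have f1E : (phi 'X)`_1 * residue mi e ^+ q = residue mi G1 * residue mi e.
  by rewrite phi1; apply: clear_denominators.
have f2E : (phi 'X)`_2 * residue mi e ^+ (q ^ 2) = residue mi G2 * residue mi e.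
  by rewrite phi2 /G2 /e [fden g1 * _]mulrC; apply: clear_denominators.
have uw : forall k, (k <= d.+2)%N -> u`_k = w k.
  apply: (@comm_rel_uniq Fq _ (residue mi 'X) (phi 'X)`_1 (phi 'X)`_2 _ w) => [|k
    kd|k kd|k kd].
  - by rewrite /w sol0.
  - have := gap0 k.+1 kd; rewrite /frob_gap rmorphB rmorphXn.
    by rewrite subr_eq0.
  - exact: u_rel.
  - by apply: comm_rel_sol; rewrite ?den0 //; exact: qE.
have p_num k : (d < k <= d.+2)%N -> p %| sol_num G1 G2 D q./2 k.
  case/andP=> dk kd; have := uw k kd; rewrite u_hi // => /esym/eqP.
  rewrite /w /sol !mulf_eq0 !invr_eq0 expf_eq0 (negPf (den0 k kd)) (negPf e0)
    (negPf u00).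
  by rewrite andbF !orbF residue_eq0.
have n_le k : (d < k <= d.+2)%N -> sol_num G1 G2 D q./2 k != 0 ->
    (n <= q ^ 2 * (2 * c + 5) * d.+1 * q ^ d)%N.
  move=> dk N0; apply: leq_trans (bound k _); last by case/andP: dk.
  have := dvdp_leq N0 (p_num k dk) => pN.
  have nN : (n <= deg (sol_num G1 G2 D q./2 k))%N.
    by rewrite /n /deg -!subn1 leq_sub2r.
  apply: leq_trans nN _.
  apply: leq_trans (@deg_sol_num _ G1 G2 D q./2 c (qE q_odd) _ _ k).
  - exact: leq_addr.
  - exact: leq_maxl.
  - exact: leq_maxr.
have [N0|N0] := sol_num_neq0 q_odd d End_psi nsq.
  by apply: n_le N0; rewrite ltnSn leqnSn.
by apply: n_le N0; rewrite leqnn ltnS leqnSn.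
Qed.
End RankTwo.

(** * From the exponential bound to the logarithmic one *)

Section LogBound.
Variable R : realType.
Local Notation expR := (@sequences.expR R).

(** From exp(-1/6) >= 5/6 and 3 (5/6)^6 > 1. It yields ln q > 1 for q >= 3, which keeps ln ln |p|
    above a positive constant. *)
Lemma expR1_lt3 : expR 1 < 3.
Proof.
have y56 : 5 / 6 <= expR (- (1 / 6)).
  by apply: le_trans (expR_ge1Dx _); lra.
have y6 : expR 1 * expR (- (1 / 6)) ^+ 6 = 1.
  by rewrite -expRM_natl -expRD (_ : _ + _ = 0) ?expR0 //; lra.
rewrite ltNge; apply/negP => e3.
have : 3 * (5 / 6) ^+ 6 <= 1 :> R.
  rewrite -[leRHS]y6; apply: ler_pM => //; first by lra.
  by rewrite lerXn2r ?nnegrE //; lra.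
by lra.
Qed.

Lemma ln_natr_gt1 (q : nat) : (2 < q)%N -> 1 < ln q%:R :> R.
Proof.
move=> q3; have q0 : (0 < q%:R :> R) by rewrite ltr0n (ltn_trans _ q3).
rewrite -ltr_expR lnK ?posrE //; apply: lt_le_trans expR1_lt3 _.
by rewrite ler_nat.
Qed.

(** With t = ln ln |p|, either d+1 is at most a constant times t^2 and the hypothesis on n suffices,
    or t < d+1 and ln |p| = e^t is itself at most q^(d+1). *)
Lemma ln_ln_le_exp (q B : nat) : (2 < q)%N -> (0 < B)%N ->
  exists2 C : R, 0 < C & forall n d : nat,
    (0 < n)%N -> (n <= B * d.+1 * q ^ d)%N ->
    C * (ln (q%:R ^+ n) / ln (ln (q%:R ^+ n)) ^+ 2) <= q%:R ^+ d.
Proof.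
move=> q3 B0; have Q1 := ln_natr_gt1 q3.
have q0 : (0 < q%:R :> R) by rewrite ltr0n (ltn_trans _ q3).
set Q : R := ln q%:R in Q1 *; have Q0 : 0 < Q by exact: lt_trans Q1.
pose l := ln Q; have l0 : 0 < l by rewrite ln_gt0.
have BR0 : 0 < B%:R :> R by rewrite ltr0n.
(* One constant for each case of the split at (d+1) l <= t^2 below. *)
exists (Num.min (l / (Q * B%:R)) (l ^+ 2 / q%:R)).
  by rewrite lt_min !divr_gt0 ?mulr_gt0 // exprn_gt0.
move=> n d n0 n_le; set C := Num.min _ _.
rewrite lnXn // -/Q -[Q *+ n]mulr_natl; set x := _ * Q.
have n1 : 1 <= n%:R :> R by rewrite ler1n.
have Qx : Q <= x by rewrite ler_peMl // ltW.
have x0 : 0 < x by exact: lt_le_trans Qx.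
pose t := ln x; have lt_ : l <= t by rewrite ler_ln ?posrE.
have t0 : 0 < t by exact: lt_le_trans lt_.
have t20 : 0 < t ^+ 2 by rewrite exprn_gt0.
rewrite -/t mulrA ler_pdivrMr //.
have [dt|td] := leP (d.+1%:R * l) (t ^+ 2).
  apply: (@le_trans _ _ (l / (Q * B%:R) * x)).
    by rewrite ler_pM2r // ge_min lexx.
  have -> : l / (Q * B%:R) * x = l * n%:R / B%:R.
    by rewrite /x; field; rewrite !gt_eqF.
  rewrite ler_pdivrMr //.
  have : n%:R <= B%:R * d.+1%:R * q%:R ^+ d :> R by rewrite -natrX -!natrM ler_nat.
  rewrite -(ler_pM2l l0) => /le_trans; apply.
  have -> : l * (B%:R * d.+1%:R * q%:R ^+ d) = (q%:R ^+ d * B%:R) * (d.+1%:R * l)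
    by ring.
  by rewrite [leRHS]mulrAC ler_wpM2l // mulr_ge0 ?ler0n // exprn_ge0 // ler0n.
(* Since l <= t, t l <= t^2 < (d+1) l, and l > 0 cancels. *)
have td1 : t < d.+1%:R.
  rewrite -(ltr_pM2r l0); apply: le_lt_trans td.
  by rewrite expr2 ler_pM2l.
have xq : x <= q%:R * q%:R ^+ d.
  rewrite -exprS -[x]lnK ?posrE // -[_ ^+ _]lnK ?posrE ?exprn_gt0 // ler_expR.
  rewrite lnXn // -/Q -/t -[Q *+ _]mulr_natl; apply: ltW; apply: lt_le_trans td1 _.
  by rewrite ler_peMr // ltW.
apply: (@le_trans _ _ (l ^+ 2 / q%:R * x)).
  by rewrite ler_pM2r // ge_min lexx orbT.
rewrite mulrAC ler_pdivrMr //.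
have -> : q%:R ^+ d * t ^+ 2 * q%:R = t ^+ 2 * (q%:R * q%:R ^+ d) by ring.
by apply: ler_pM => //; rewrite ?exprn_ge0 ?lerXn2r ?nnegrE // ltW.
Qed.
End LogBound.

Theorem theorem1 (R : realType) (Fq : finFieldType) (q_odd : odd #|Fq|)
  (Falg : closedFieldType) (iota : {rmorphism {fraction {poly Fq}} -> Falg})
  (Falg_algebraic : forall x : Falg, algebraicOver iota x)
  (psi : {rmorphism {poly Fq} -> twist (@FracField.tofrac {poly Fq})})
  (psi_rank2 : is_drinfeld 2 psi)
  (End_psi : forall u : twist (iota \o @FracField.tofrac {poly Fq}),
     u \in endo (base_change iota psi) <-> exists a, u = base_change iota psi a) :
  exists2 C : R, 0 < C &
    forall (p : {poly Fq}) (mi : monic_irreducible_poly p),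
      good_reduction p psi ->
    forall (K : fieldExtType {fraction {poly Fq}})
      (j : {rmorphism endo_ring (reduction mi psi) -> K}),
      generated_field j (frobenius (reduction mi psi)) ->
    forall alpha : 'I_2 -> endo_ring (reduction mi psi),
      endo_basis alpha ->
    exists2 Delta : {poly Fq}, FracField.tofrac Delta = endo_disc j alpha &
      C * (ln (absA R p) / (ln (ln (absA R p))) ^+ 2) <= absA R Delta.
Proof.
have [B B0 deg_p] := deg_prime_le psi_rank2 q_odd (fun u => proj1 (End_psi u)).
have q3 : (2 < #|Fq|)%N.
  by have := finNzRing_gt1 Fq; move: q_odd; case: #|Fq| => [|[|[|]]].
have [C C0 CP] := ln_ln_le_exp R q3 B0.
exists C => // p mi good K j j_gen alpha alphaP.
have [beta [Delta [DE beta2 nsq]]] := endo_disc_sqr j_gen alphaP (odd_card2_neq0 q_odd).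
exists Delta => //.
have D0 : Delta != 0 by have := nsq 0; rewrite expr0n.
have [[p1 _] pmon] := mi.
have u2 : (val beta : twist (residue mi)) ^+ 2 = reduction mi psi Delta.
  by rewrite expr2 -[LHS](rmorphM val) -expr2 beta2.
rewrite /absA (negPf D0) (negPf (monic_neq0 pmon)).
apply: CP; first by rewrite -subn1 subn_gt0.
have := deg_p p mi good Delta (val beta) (valP beta) u2 nsq.
by rewrite prednK // size_poly_gt0.
Qed.
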